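(* For any $\gamma>0$ there exists $\delta>0$ such that the following holds for all $n$. Let $G$ be an $n$-vertex graph containing no copy of $K_8$ with $\alpha(G)\le \delta\sqrt{n\log n}$. Then $e(G)\le \frac{n^2}{4}+\gamma n^2$.
   Context: $\alpha(G)$ is the independence number of $G$, $e(G)$ its number of edges, and $K_8$ the complete graph on 8 vertices. *)

(* Defs.v *)
From HB Require Import structures.
From mathcomp Require Import all_boot all_order all_algebra.

Set Implicit Arguments.
Unset Strict Implicit.
Unset Printing Implicit Defensive.

(* Finite simple graph on the vertex type T. *)
Record sgraph (T : finType) := SGraph {
  adj : rel T;
  adj_sym : symmetric adj;
  adj_irrefl : irreflexive adj }.

Definition complete_rel (k : nat) : rel 'I_k := fun i j => i != j.

Lemma complete_rel_sym k : symmetric (@complete_rel k).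
Proof. by move=> i j; rewrite /complete_rel eq_sym. Qed.

Lemma complete_rel_irrefl k : irreflexive (@complete_rel k).
Proof. by move=> i; rewrite /complete_rel eqxx. Qed.

Definition complete_graph (k : nat) : sgraph 'I_k :=
  SGraph (@complete_rel_sym k) (@complete_rel_irrefl k).

(* A copy of H in G is a subgraph of G, not necessarily induced. *)
Definition contains_copy (S T : finType) (H : sgraph S) (G : sgraph T) : Prop :=
  exists f : S -> T,
    injective f /\ forall x y : S, adj H x y -> adj G (f x) (f y).

Definition independent (T : finType) (G : sgraph T) (A : {set T}) : bool :=
  [forall x in A, forall y in A, ~~ adj G x y].

Definition independence_number (T : finType) (G : sgraph T) : nat :=
  \max_(A : {set T} | independent G A) #|A|.

(* Edges are unordered pairs, so each is counted once. *)
Definition edges (T : finType) (G : sgraph T) : {set {set T}} :=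
  [set [set p.1; p.2] | p : T * T & adj G p.1 p.2].

Definition num_edges (T : finType) (G : sgraph T) : nat := #|edges G|.

(* Main.v *)
Require Import Defs.
From HB Require Import structures.
From mathcomp Require Import all_boot all_order all_algebra zify ring lra.

(* Small independence number puts a triangle into every linear-size vertex set
   (Ajtai-Komlos-Szemeredi), and, by dependent random choice, puts an edge with
   linear-size common neighbourhoods into every linear-size set that is dense to a
   few others.  Starting from k copies of the whole vertex set, maximise the sum of
   the pair densities plus a small quadratic term over k-tuples of linear-size sets:
   at a near-maximum every pair is regular, and the average density is still above
   1/2.  A weighted Turan argument then finds among the k sets either four that are
   pairwise dense, giving a clique of size 2 + 2 + 2 + 2, or three that are pairwise
   dense with one density above 3/4, giving 2 + 3 + 3: after the edge in the third
   set, each vertex of a triangle in the first one misses less than a third of what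
   is left of the second. *)

Set Implicit Arguments.
Unset Strict Implicit.
Unset Printing Implicit Defensive.

(** * Independent sets in triangle-free graphs *)

(** The order sqrt(n log n) is needed for triangles: a triangle-free set of size s forces s * log n
    = O(alpha^2), which a small [delta] contradicts once s is linear in n. Edges have room to spare,
    since dependent random choice keeps at least a constant times n^(3/4) vertices, far more than
    alpha. The value 3/4 is constrained from both sides. Two edges of weight at most 3/4 from a
    vertex into a triangle add up to 3/2, half the size of the triangle, which is all that the Turan
    induction can afford. The 2 + 3 + 3 embedding works for densities above 2/3, so 3/4 leaves room
    for the regularity error. A single tuple of possibly overlapping sets replaces a regular
    partition: the Turan count sees only the average density of pairs, and the maximisation
    preserves that average up to the quadratic term. The constants are chosen in the order [eps],
    [sigma], [delta]; [eps] depends on [gamma] alone, which is what keeps the choice from being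
    circular. *)

Section TriangleFree.
Variables (T : finType) (G : sgraph T).
Local Notation e := (adj G).

Definition nbr (v : T) (A : {set T}) : {set T} := [set x in A | e v x].

Lemma independentP (A : {set T}) :
  reflect {in A &, forall x y, ~~ e x y} (independent G A).
Proof.
apply: (iffP forall_inP) => [H x y xA yA|H x xA]; first exact: (forall_inP (H x xA)).
by apply/forall_inP => y yA; exact: H.
Qed.

Lemma independent_card (A : {set T}) :
  independent G A -> #|A| <= independence_number G.
Proof. by move=> iA; apply: (leq_bigmax_cond (F := fun A : {set T} => #|A|)). Qed.

Lemma edge_of_card (A : {set T}) : independence_number G < #|A| ->
  exists x y, [/\ x \in A, y \in A & e x y].
Proof.
move=> ltA; have: ~~ independent G A.
  by apply: contraTN ltA => iA; rewrite -leqNgt independent_card.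
rewrite negb_forall => /existsP[x]; rewrite negb_imply => /andP[xA].
rewrite negb_forall => /existsP[y]; rewrite negb_imply negbK => /andP[yA exy].
by exists x, y.
Qed.

(** Pairing each [Y] with its complement in [X] makes the average size [#|X| / 2]. *)
Lemma sum_card_powerset (X : {set T}) :
  2 * \sum_(Y in powerset X) #|Y| = #|X| * 2 ^ #|X|.
Proof.
have E : \sum_(Y in powerset X) #|Y| = \sum_(Y in powerset X) #|X :\: Y|.
  rewrite (reindex_onto (fun Y => X :\: Y) (fun Y => X :\: Y)) /=; last first.
    by move=> Y; rewrite powersetE => YX; rewrite setDDr setDv set0U; apply/setIidPr.
  apply: eq_bigl => Y; rewrite !powersetE subsetDl setDDr setDv set0U /=.
  by apply/eqP/idP => [<-|/setIidPr //]; apply: subsetIl.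
rewrite mul2n -addnn {2}E -big_split /= -card_powerset.
rewrite (eq_bigr (fun=> #|X|)) ?sum_nat_const 1?mulnC // => Y.
rewrite powersetE => YX; rewrite -(cardsID Y X); congr (_ + _).
by rewrite (setIidPr YX).
Qed.

(** If [x < 2 * l], then [D] alone pays, being at least [l * (4 ^ l).+1]. Otherwise subsets have
    average size at least [l], so [s] pays for [l * 2 ^ x] and [D] for the remaining [l]. *)
Lemma fiber_arith (D l x s : nat) :
  l * (4 ^ l).+1 <= D -> 2 * s = x * 2 ^ x -> l * (2 ^ x).+1 <= D + s.
Proof.
move=> hD hs; have [xl|lx] := ltnP x (2 * l).
  have : 2 ^ x <= 4 ^ l by rewrite (_ : 4 = 2 ^ 2) // -expnM leq_exp2l // ltnW.
  by nia.
have : 0 < 4 ^ l by rewrite expn_gt0.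
by nia.
Qed.

Section Fixed.
Variables (S : {set T}) (D l : nat).
Hypothesis S_tfree : {in S & &, forall x y z, e x y -> e y z -> e x z -> False}.
Hypothesis D_big : l * (4 ^ l).+1 <= D.

Let F := [set I in powerset S | independent G I].

(* Fix I outside the closed neighbourhood of v: the remaining choices for I are
   adding v, or adding any subset of the set X of still available neighbours.  So
   unless 2 ^ #|X| is large, v itself is chosen often. *)
Lemma local_occupancy (v : T) : v \in S ->
  #|F| * l <= \sum_(I in F) (D * (v \in I) + #|nbr v S :&: I|).
Proof.
move=> vS; set N := nbr v S; set h := fun I : {set T} => I :\: (v |: N).
rewrite -sum_nat_const (partition_big h predT) //= [leqRHS](partition_big h predT) //=.
apply: leq_sum => H _.
have [/existsP[I0 /andP[I0F /eqP hI0]]|] := boolP [exists I, (I \in F) && (h I == H)]; last first.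
  rewrite negb_exists => /forallP nH; rewrite big1 // => I /andP[IF hI].
  by have := nH I; rewrite IF hI.
have [I0S I0ind] : I0 \subset S /\ independent G I0.
  by move: I0F; rewrite inE powersetE => /andP.
have HS : H \subset S by rewrite -hI0; apply: subset_trans (subsetDl _ _) I0S.
have Hind x y : x \in H -> y \in H -> ~~ e x y.
  by rewrite -hI0 !inE => /andP[_ xI] /andP[_ yI]; apply: (independentP _ I0ind).
have Hv : v \notin H by rewrite -hI0 !inE eqxx.
have HN x : x \in H -> x \notin N by rewrite -hI0 !inE negb_or => /andP[/andP[]].
have NS : N \subset S by apply/subsetP => x; rewrite inE => /andP[].
have vN : v \notin N by rewrite inE adj_irrefl andbF.
have Nind x y : x \in N -> y \in N -> ~~ e x y.
  rewrite !inE => /andP[xS vx] /andP[yS vy]; apply/negP => xy.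
  exact: (S_tfree vS xS yS).
pose X := [set u in N | [forall x in H, ~~ e u x]].
have XN : X \subset N by apply/subsetP => u; rewrite inE => /andP[].
have fibv (I : {set T}) : (I \in F) && (h I == H) && (v \in I) = (I == v |: H).
  apply/idP/eqP => [/andP[/andP[IF /eqP hI] vI]|->].
    move: IF; rewrite inE powersetE => /andP[IS /independentP iI].
    apply/setP => x; rewrite -hI !inE; have [->|xv] //= := eqVneq x v.
    have [xI|//] := boolP (x \in I); last by rewrite andbF.
    by rewrite (negbTE (iI _ _ vI xI)) andbF.
  rewrite setU11 andbT inE powersetE subUset sub1set vS HS /=; apply/andP; split.
    have vH x : x \in H -> ~~ e v x.
      move=> xH; apply: contra (HN x xH) => vx; rewrite inE vx andbT.
      exact: (subsetP HS).
    apply/independentP => x y /setU1P[->|xH] /setU1P[->|yH].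
    - by rewrite adj_irrefl.
    - exact: vH.
    - by rewrite adj_sym vH.
    - exact: Hind.
  apply/eqP/setP => x; rewrite !inE negb_or; have [->|xv] //= := eqVneq x v.
    by rewrite (negbTE Hv).
  have [xH|//] := boolP (x \in H); last by rewrite andbF.
  by have := HN _ xH; rewrite inE andbT.
have fibX (I : {set T}) : (I \in F) && (h I == H) && (v \notin I) =
    (H \subset I) && (I :\: H \subset X) .
  apply/idP/idP => [/andP[/andP[IF /eqP hI] vI]|/andP[HI IX]].
    move: IF; rewrite inE powersetE => /andP[IS /independentP iI].
    rewrite -{1}hI subsetDl; apply/subsetP => x /setDP[xI xH]; rewrite inE.
    have xN : x \in N.
      move: xH; rewrite -hI in_setD xI andbT negbK in_setU1.
      by case/orP => // /eqP xv; move: vI; rewrite -xv xI.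
    rewrite xN; apply/forall_inP => y; rewrite -hI => /setDP[yI _].
    exact: iI.
  have Isplit x : x \in I -> (x \in H) || (x \in X).
    move=> xI; have [//|xH] := boolP (x \in H).
    by apply: (subsetP IX); rewrite inE xH.
  have XH x y : x \in X -> y \in H -> ~~ e x y.
    by rewrite inE => /andP[_ /forall_inP]; apply.
  apply/andP; split; last first.
    apply/negP => /Isplit; rewrite (negbTE Hv) => /(subsetP XN).
    by rewrite (negbTE vN).
  apply/andP; split.
    rewrite inE powersetE; apply/andP; split.
      apply/subsetP => x /Isplit /orP[/(subsetP HS)//|/(subsetP XN)].
      exact: (subsetP NS).
    apply/independentP => x y /Isplit/orP[xH|xX] /Isplit/orP[yH|yX].
    - exact: Hind.
    - by rewrite adj_sym XH.
    - exact: XH.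
    - by apply: Nind; apply: (subsetP XN).
  apply/eqP/setP => x; rewrite in_setD in_setU1 negb_or.
  apply/idP/idP => [/andP[/andP[xv xN] /Isplit/orP[//|/(subsetP XN)]]|xH].
    by rewrite (negbTE xN).
  rewrite HN // (subsetP HI) // !andbT.
  by apply: contraNneq Hv => <-.
have HX : [disjoint H & X].
  by apply/pred0P => x /=; apply/negP => /andP[/HN xN /(subsetP XN)]; apply/negP.
have sumX f : \sum_(I | (I \in F) && (h I == H) && (v \notin I)) f I
    = \sum_(Y in powerset X) f (H :|: Y).
  rewrite (eq_bigl _ _ fibX).
  rewrite (reindex_onto (fun Y => H :|: Y) (fun I => I :\: H)) /=; last first.
    by move=> I /andP[HI _]; rewrite setDE setUIr setUCr setIT; apply/setUidPr.
  apply: eq_bigl => Y; rewrite powersetE subsetUl setDUl setDv set0U /=.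
  apply/andP/idP => [[YX /eqP <-]//|YX].
  have /setDidPl -> // : [disjoint (Y : {set T}) & H].
    by rewrite disjoint_sym; apply: disjointWr YX HX.
rewrite (bigID (fun I : {set T} => v \in I)) /= [leqRHS](bigID (fun I : {set T} => v \in I)) /=.
rewrite !sumX !(eq_bigl _ _ fibv) !big_pred1_eq.
have /(fiber_arith D_big) := sum_card_powerset X.
set s := \sum_(Y in powerset X) #|Y| => fa.
apply: leq_trans (leq_trans fa _).
  by rewrite sum_nat_const card_powerset -mulSn mulnC.
apply: leq_add; first by rewrite setU11 muln1 leq_addr.
apply: leq_sum => Y; rewrite powersetE => YX; apply: leq_trans (leq_addl _ _).
apply: subset_leq_card; rewrite subsetI subsetUr andbT.
exact: subset_trans YX XN.
Qed.

(** Sum the local bound over [v] for a uniformly random independent set [I]. The first term gives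
    [D * #|I|]; the second gives the degrees of the members of [I], each at most [D] because
    neighbourhoods in [S] are independent. *)
Lemma triangle_free_bound : independence_number G <= D ->
  #|S| * l <= 2 * D * independence_number G.
Proof.
set a := independence_number G => aD.
have F0 : 0 < #|F|.
  apply/card_gt0P; exists set0; rewrite !inE sub0set /=.
  by apply/independentP => x y; rewrite inE.
rewrite -(leq_pmul2l F0) mulnCA -sum_nat_const.
apply: leq_trans (_ : _ <= \sum_(v in S) \sum_(I in F) (D * (v \in I) + #|nbr v S :&: I|)) _.
  by apply: leq_sum => v; exact: local_occupancy.
rewrite exchange_big /= -sum_nat_const; apply: leq_sum => I.
rewrite inE powersetE => /andP[IS iI].
have Ia : #|I| <= a by exact: independent_card.
rewrite big_split /= -big_distrr /=.
have -> : \sum_(v in S) (v \in I) = #|I|.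
  rewrite -sum1_card [LHS]big_mkcond [RHS]big_mkcond; apply: eq_bigr => v _ /=.
  by have [/(subsetP IS) ->|_] := boolP (v \in I); last by case: ifP.
have E : \sum_(v in S) #|nbr v S :&: I| = \sum_(u in I) #|nbr u S|.
  under eq_bigr do rewrite -sum1_card big_mkcond.
  under [RHS]eq_bigr do rewrite -sum1_card big_mkcond.
  rewrite exchange_big [RHS]big_mkcond; apply: eq_bigr => u _ /=.
  rewrite [LHS]big_mkcond /=; have [uI|uI] := boolP (u \in I); last first.
    by apply: big1 => v _; rewrite in_setI (negbTE uI) andbF; case: ifP.
  apply: eq_bigr => v _; rewrite !inE uI (subsetP IS _ uI) andbT /= adj_sym.
  by case: (v \in S).
have : \sum_(u in I) #|nbr u S| <= #|I| * D.
  rewrite -sum_nat_const; apply: leq_sum => u uI.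
  apply: leq_trans aD; apply: independent_card; apply/independentP => x y.
  rewrite !inE => /andP[xS ux] /andP[yS uy]; apply/negP => xy.
  exact: (S_tfree (subsetP IS _ uI) xS yS ux xy uy).
by rewrite E; nia.
Qed.

End Fixed.
End TriangleFree.

Import Order.TTheory GRing.Theory Num.Theory.
Local Open Scope ring_scope.

(** * Dependent random choice *)

Lemma double_count (X Y : finType) (A : {set X}) (B : {set Y}) (r : X -> Y -> bool) :
  (\sum_(x in A) #|[set y in B | r x y]| = \sum_(y in B) #|[set x in A | r x y]|)%N.
Proof.
under eq_bigr do rewrite -sum1_card big_mkcond.
under [RHS]eq_bigr do rewrite -sum1_card big_mkcond.
rewrite exchange_big [RHS]big_mkcond; apply: eq_bigr => y _ /=.
have [yB|yB] := boolP (y \in B); last by apply: big1 => x _; rewrite inE (negbTE yB).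
rewrite [LHS]big_mkcond; apply: eq_bigr => x _ /=; rewrite !inE yB /=.
by case: (x \in A).
Qed.

Lemma exists_ge_avg (R : realFieldType) (X : finType) (A : {set X}) (f : X -> R) (m : R) :
  A != set0 -> m * #|A|%:R <= \sum_(x in A) f x -> exists2 x, x \in A & m <= f x.
Proof.
case/set0Pn => x0 x0A H.
have [/existsP[x /andP[xA mx]]|] := boolP [exists x, (x \in A) && (m <= f x)].
  by exists x.
rewrite negb_exists => /forallP lt; move: H; rewrite leNgt => /negP[].
rewrite mulr_natr -sumr_const; apply: ltr_sum.
  by apply/hasP; exists x0; rewrite ?mem_index_enum.
by move=> x xA; have := lt x; rewrite xA /= -ltNge.
Qed.

Section DependentChoice.
Variables (R : realFieldType) (T : finType) (G : sgraph T).
Local Notation e := (adj G).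
Local Notation nbr := (nbr G).

Lemma nbrP v A x : (x \in nbr v A) = (x \in A) && e v x.
Proof. by rewrite inE. Qed.

Definition bad_pairs (eps : R) (A C : {set T}) : {set T * T} :=
  [set p in setX C C | #|nbr p.1 (nbr p.2 A)|%:R < eps * #|A|%:R].

Variables eta eps : R.
Hypotheses (eta0 : 0 < eta) (eps0 : 0 < eps).

(** Take [C'] to be the neighbourhood in [C] of a random vertex of [A]. A vertex of [C] survives
    with probability at least [eta], a bad pair with probability below [eps]; linearity of
    expectation gives the bound. *)
Lemma drc_step (A C : {set T}) (lam : R) : A != set0 -> 0 <= lam ->
  {in C, forall v, eta * #|A|%:R <= #|nbr v A|%:R} ->
  exists2 C' : {set T}, C' \subset C &
    eta * #|C|%:R - lam * eps * #|bad_pairs eps A C|%:R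
      <= #|C'|%:R - lam * #|bad_pairs eps A C'|%:R.
Proof.
move=> A0 lam0 degC.
have [|a aA Ha] := @exists_ge_avg R T A
   (fun a => #|nbr a C|%:R - lam * #|bad_pairs eps A (nbr a C)|%:R)
   (eta * #|C|%:R - lam * eps * #|bad_pairs eps A C|%:R) A0.
  rewrite sumrB -mulr_sumr -!natr_sum.
  have -> : (\sum_(a in A) #|nbr a C| = \sum_(c in C) #|nbr c A|)%N.
    rewrite double_count; apply: eq_bigr => c _; apply: eq_card => x.
    by rewrite !inE adj_sym.
  have -> : (\sum_(a in A) #|bad_pairs eps A (nbr a C)| =
      \sum_(p in bad_pairs eps A C) #|nbr p.1 (nbr p.2 A)|)%N.
    under eq_bigr => a _.
      rewrite (_ : bad_pairs eps A (nbr a C) =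
         [set p in bad_pairs eps A C | e a p.1 && e a p.2]); last first.
        apply/setP => -[x y]; rewrite !inE /=.
        by case: (x \in C); case: (y \in C); case: (e a x); case: (e a y); rewrite ?andbT ?andbF.
      over.
    rewrite double_count; apply: eq_bigr => -[x y] _; apply: eq_card => a.
    by rewrite !inE /= (adj_sym G a x) (adj_sym G a y) andbAC andbA.
  rewrite mulrBl; apply: lerB.
    have -> : eta * #|C|%:R * #|A|%:R = \sum_(c in C) (eta * #|A|%:R).
      by rewrite sumr_const -[RHS]mulr_natr mulrAC.
    by rewrite natr_sum; apply: ler_sum => c cC; apply: degC.
  rewrite -!mulrA ler_wpM2l //.
  have -> : eps * (#|bad_pairs eps A C|%:R * #|A|%:R)
      = \sum_(p in bad_pairs eps A C) (eps * #|A|%:R).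
    by rewrite sumr_const -[RHS]mulr_natr; ring.
  by rewrite natr_sum; apply: ler_sum => p; rewrite inE => /andP[_ /ltW].
by exists (nbr a C) => //; apply/subsetP => x; rewrite nbrP => /andP[].
Qed.

(** Relative to the size, each round shrinks the bad pairs by [eps / eta]. The first round therefore
    runs with the discounted penalty [lam * (eps / eta) ^+ t], and the penalty grows back to [lam]
    at the last one. *)
Lemma drc_iter (A : {set T}) (lam : R) (t : nat) (C : {set T}) : A != set0 -> 0 <= lam ->
  {in C, forall v, eta * #|A|%:R <= #|nbr v A|%:R} ->
  exists2 C' : {set T}, C' \subset C &
    eta ^+ t * (#|C|%:R - lam * (eps / eta) ^+ t * #|bad_pairs eps A C|%:R)
      <= #|C'|%:R - lam * #|bad_pairs eps A C'|%:R.
Proof.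
move=> A0 lam0; elim: t C => [|t IH] C degC.
  by exists C; rewrite // !expr0 mul1r mulr1.
have lam'0 : 0 <= lam * (eps / eta) ^+ t.
  by rewrite mulr_ge0 // exprn_ge0 // divr_ge0 // ltW.
have [C1 C1C H1] := drc_step A0 lam'0 degC.
have [|C2 C2C H2] := IH C1; first by move=> v /(subsetP C1C); apply: degC.
exists C2; first exact: subset_trans C2C C1C.
apply: le_trans H2; move: H1; rewrite -(ler_pM2l (exprn_gt0 t eta0)); apply: le_trans.
rewrite le_eqVlt; apply/orP; left; apply/eqP; rewrite !exprS.
by set u := (_ / _) ^+ t; field; rewrite lt0r_neq0.
Qed.

(* With the penalty [lam = #|T|], a single surviving bad pair would make the
   potential nonpositive. *)
Lemma drc_clean (A : {set T}) (t : nat) (C : {set T}) : A != set0 -> (1 < #|C|)%N ->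
  #|T|%:R ^+ 3 * (eps / eta) ^+ t <= 1 ->
  {in C, forall v, eta * #|A|%:R <= #|nbr v A|%:R} ->
  exists C' : {set T}, [/\ C' \subset C, eta ^+ t / 2 * #|C|%:R <= #|C'|%:R &
    {in C' &, forall c c', eps * #|A|%:R <= #|nbr c (nbr c' A)|%:R}].
Proof.
move=> A0 C1 small degC.
have [C' C'C H] := drc_iter t A0 (ler0n R #|T|) degC.
have et0 : 0 < eta ^+ t by rewrite exprn_gt0.
have C2 : 2 <= #|C|%:R :> R by rewrite (ler_nat _ 2).
have L : eta ^+ t / 2 * #|C|%:R <= #|C'|%:R - #|T|%:R * #|bad_pairs eps A C'|%:R.
  apply: le_trans H; rewrite -mulrA ler_wpM2l ?(ltW et0) //.
  (* There are at most [#|T| ^ 2] bad pairs, so [small] bounds the initial penalty by 1, at most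
     half of [#|C|]. *)
  have : #|T|%:R * (eps / eta) ^+ t * #|bad_pairs eps A C|%:R <= 1; last first.
    set X := _ * _ * _ => X1; clear -C2 X1; lra.
  apply: le_trans small; rewrite mulrAC; apply: ler_wpM2r.
    by rewrite exprn_ge0 // divr_ge0 // ltW.
  rewrite -natrM -natrX ler_nat expnS leq_mul2l; apply/orP; right.
  rewrite -mulnn -card_prod; exact: max_card.
have C'T : #|C'|%:R <= #|T|%:R :> R by rewrite ler_nat max_card.
have B0 : bad_pairs eps A C' = set0.
  apply/eqP; rewrite -cards_eq0 -leqn0 leqNgt; apply/negP => B1.
  have {}B1 : 1 <= #|bad_pairs eps A C'|%:R :> R by rewrite (ler_nat _ 1).
  have : #|T|%:R <= #|T|%:R * #|bad_pairs eps A C'|%:R :> R.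
    by rewrite ler_peMr.
  have : 0 < eta ^+ t / 2 * #|C|%:R by rewrite mulr_gt0 ?divr_gt0 //; lra.
  by lra.
exists C'; split=> //; first by apply: le_trans L _; rewrite gerBl mulr_ge0.
move=> c c' cC c'C; rewrite leNgt; apply/negP => lt.
have : (c, c') \in bad_pairs eps A C' by rewrite !inE cC c'C.
by rewrite B0 inE.
Qed.

(** Clean [C] against the members of [s] one at a time: the degree hypotheses and the guarantees
    already obtained pass to subsets of [C], so each member costs only one factor [eta ^+ t / 2]. *)
Lemma drc_seq (s : seq {set T}) (t : nat) (C : {set T}) :
  eta <= 1 -> #|T|%:R ^+ 3 * (eps / eta) ^+ t <= 1 ->
  2 <= (eta ^+ t / 2) ^+ size s * #|C|%:R ->
  {in s, forall A : {set T}, A != set0 /\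
     {in C, forall v, eta * #|A|%:R <= #|nbr v A|%:R}} ->
  exists C' : {set T}, [/\ C' \subset C, (eta ^+ t / 2) ^+ size s * #|C|%:R <= #|C'|%:R &
    {in s, forall A : {set T},
      {in C' &, forall c c', eps * #|A|%:R <= #|nbr c (nbr c' A)|%:R}}].
Proof.
move=> eta1 small; set w := eta ^+ t / 2.
have w0 : 0 < w by rewrite divr_gt0 // exprn_gt0.
have w1 : w <= 1.
  have : eta ^+ t <= 1 by rewrite exprn_ile1 // ltW.
  by rewrite /w; lra.
elim: s C => [|A s IH] C /= big degC.
  by exists C; split=> //; rewrite expr0 mul1r.
have [A0 degA] := degC A (mem_head _ _).
have C1 : (1 < #|C|)%N.
  rewrite -(ler_nat R); apply: le_trans big _.
  by rewrite ler_piMl // exprn_ile1 // ltW.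
have [C1' [C1C C1w good1]] := drc_clean A0 C1 small degA.
have wC : w ^+ (size s).+1 * #|C|%:R <= w ^+ size s * #|C1'|%:R.
  by rewrite exprSr -mulrA ler_wpM2l // exprn_ge0 // ltW.
have [||C' [C'C C'w good]] := IH C1'.
- exact: le_trans big wC.
- move=> B Bs; have [|B0 degB] := degC B; first by rewrite inE Bs orbT.
  by split=> // v /(subsetP C1C); apply: degB.
exists C'; split=> //.
- exact: subset_trans C'C C1C.
- exact: le_trans wC C'w.
- move=> B; rewrite inE => /orP[/eqP->|]; last exact: good.
  by move=> c c' cC c'C; apply: good1; apply: (subsetP C'C).
Qed.

End DependentChoice.

(** * Embedding K_8 *)

Section Embedding.
Variables (R : realFieldType) (T : finType) (G : sgraph T).
Local Notation e := (adj G).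
Local Notation nbr := (nbr G).
Local Notation n := (#|T|%:R : R).

(** As a fold, it reduces on [[:: c; c']] to [nbr c (nbr c' A)], the form produced by dependent
    random choice. *)
Definition common_nbr (s : seq T) (A : {set T}) : {set T} := foldr nbr A s.

Lemma in_common_nbr s A x : (x \in common_nbr s A) = (x \in A) && all (e^~ x) s.
Proof.
elim: s => [|y s IH] /=; first by rewrite andbT.
by rewrite nbrP IH -andbA [all _ _ && _]andbC.
Qed.

Lemma common_nbr_sub s A : common_nbr s A \subset A.
Proof. by apply/subsetP => x; rewrite in_common_nbr => /andP[]. Qed.

Lemma common_nbrS s (A B : {set T}) : A \subset B -> common_nbr s A \subset common_nbr s B.
Proof.
by move=> /subsetP AB; apply/subsetP => x; rewrite !in_common_nbr => /andP[/AB -> ->].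
Qed.

Definition has_clique (m : nat) (A : {set T}) : Prop :=
  exists s : seq T, [/\ size s = m, {subset s <= A} & pairwise e s].

Lemma has_clique_sub m (A B : {set T}) : A \subset B -> has_clique m A -> has_clique m B.
Proof.
move=> AB [s [sm sA ps]]; exists s; split=> // x /sA; exact: (subsetP AB).
Qed.

Lemma has_clique_join s m (W : {set T}) : {subset s <= W} -> pairwise e s ->
  has_clique m (common_nbr s W) -> has_clique (size s + m) W.
Proof.
move=> sW ps [s' [<- s'W ps']]; exists (s ++ s'); split.
- by rewrite size_cat.
- move=> x; rewrite mem_cat => /orP[/sW//|/s'W].
  exact: (subsetP (common_nbr_sub _ _)).
- rewrite pairwise_cat ps ps' !andbT; apply/allrelP => x y xs /s'W.
  by rewrite in_common_nbr => /andP[_ /allP]; apply.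
Qed.

Lemma has_clique_copy m : has_clique m [set: T] -> contains_copy (complete_graph m) G.
Proof.
case=> s [sm _ ps].
have [m0|[x0 _]] : (m = 0)%N \/ exists x0, x0 \in s.
- by case: s sm {ps} => [<-|x s _]; [left|right; exists x; rewrite mem_head].
- rewrite m0; exists (fun i : 'I_0 => False_rect T (notF (ltn_ord i))).
  by split=> -[].
have ij (i j : 'I_m) : (i < j)%N -> e (nth x0 s i) (nth x0 s j).
  by move=> lt; apply: (pairwiseP x0 ps) lt; rewrite inE sm.
have adj_nth (i j : 'I_m) : i != j -> e (nth x0 s i) (nth x0 s j).
  rewrite neq_ltn => /orP[/ij //|/ij].
  by rewrite adj_sym.
exists (fun i : 'I_m => nth x0 s i); split=> // i j eq.
by apply/eqP; apply: contraT => /adj_nth; rewrite eq adj_irrefl.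
Qed.

Definition triangle_rich (sigma : R) : Prop :=
  forall S : {set T}, sigma * n <= #|S|%:R -> has_clique 3 S.

(** Three is the number of other sets that the first edge of the 2 + 2 + 2 + 2 embedding has to
    serve. *)
Definition edge_rich (eta eps sigma : R) : Prop :=
  forall (C : {set T}) (s : seq {set T}), (size s <= 3)%N -> sigma * n <= #|C|%:R ->
  {in s, forall A : {set T}, A != set0 /\
     {in C, forall v, eta * #|A|%:R <= #|nbr v A|%:R}} ->
  exists c c', [/\ c \in C, c' \in C, e c c' &
    {in s, forall A : {set T}, eps * #|A|%:R <= #|common_nbr [:: c; c'] A|%:R}].

Definition edge_count (A B : {set T}) : nat := (\sum_(a in A) #|nbr a B|)%N.

(** The lower half of regularity, which is all that the embeddings use. *)
Definition hered_dense (rho r : R) (A B : {set T}) : Prop :=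
  forall A' B' : {set T}, A' \subset A -> B' \subset B ->
    rho * #|A|%:R <= #|A'|%:R -> rho * #|B|%:R <= #|B'|%:R ->
    r * (#|A'|%:R * #|B'|%:R) <= (edge_count A' B')%:R.

Definition low_degree (r : R) (A B : {set T}) : {set T} :=
  [set v in A | #|nbr v B|%:R < r * #|B|%:R].

Lemma low_degree_small rho r (A B B' : {set T}) : 0 < rho -> A != set0 ->
  hered_dense rho r A B -> B' \subset B -> rho * #|B|%:R <= #|B'|%:R ->
  #|low_degree r A B'|%:R <= rho * #|A|%:R.
Proof.
move=> rho0 A0 hd B'B bB'; rewrite leNgt; apply/negP => lt.
set L := low_degree r A B' in lt.
have LA : L \subset A by apply/subsetP => x; rewrite inE => /andP[].
have := hd L B' LA B'B (ltW lt) bB'; rewrite leNgt => /negP[].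
have L0 : L != set0.
  by apply: contraTneq lt => ->; rewrite cards0 -leNgt mulr_ge0 // ltW.
case/set0Pn: (L0) => x xL.
rewrite mulrCA mulr_natl -sumr_const natr_sum; apply: ltr_sum.
  by apply/hasP; exists x; rewrite ?mem_index_enum.
by move=> y; rewrite inE => /andP[].
Qed.

Lemma card_setI_ge (A B W : {set T}) : A \subset W -> B \subset W ->
  #|A|%:R + #|B|%:R - #|W|%:R <= #|A :&: B|%:R :> R.
Proof.
move=> AW BW; rewrite lerBlDr -!natrD ler_nat -cardsUI [leqRHS]addnC leq_add2r.
by apply: subset_leq_card; rewrite subUset AW.
Qed.

(** [C0] is what earlier choices have left of [C]. Low-degree vertices are few relative to the
    original [C]; deleting them for each of at most three sets still leaves [sigma * n] vertices of
    [C0], and [edge_rich] applies to those. *)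
Lemma edge_step eta eps sigma rho (C C0 : {set T}) (s : seq {set T}) :
  edge_rich eta eps sigma -> C0 \subset C -> (size s <= 3)%N -> 0 <= rho ->
  {in s, forall B : {set T}, B != set0 /\ #|low_degree eta C B|%:R <= rho * #|C|%:R} ->
  sigma * n + 3 * (rho * #|C|%:R) <= #|C0|%:R ->
  exists c c', [/\ c \in C0, c' \in C0, e c c' &
    {in s, forall A : {set T}, eps * #|A|%:R <= #|common_nbr [:: c; c'] A|%:R}].
Proof.
move=> rich C0C s3 rho0 lowB big.
set r := rho * _ in lowB big.
have r0 : 0 <= r by rewrite mulr_ge0.
pose good s := [set v in C0 | all (fun B : {set T} => eta * #|B|%:R <= #|nbr v B|%:R) s].
have goodC s' : good s' \subset C0 by apply/subsetP => x; rewrite inE => /andP[].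
have card_good : forall s', {in s', forall B : {set T}, #|low_degree eta C B|%:R <= r} ->
    #|C0|%:R - (size s')%:R * r <= #|good s'|%:R.
  elim=> [|B s' IH] lows; first by rewrite mul0r subr0 ler_nat subset_leq_card //
    ; apply/subsetP => x xC; rewrite inE xC.
  have {}IH := IH (fun B' B's => lows B' (@mem_behead _ (B :: s') B' B's)).
  have lB := lows B (mem_head _ _).
  have -> : good (B :: s') = good s' :\: low_degree eta C B.
    apply/setP => v; rewrite !inE /=; have [vC|//] := boolP (v \in C0); last by rewrite andbF.
    by rewrite (subsetP C0C) //= -leNgt.
  have := cardsID (low_degree eta C B) (good s') => /(congr1 (fun k => k%:R : R)).
  rewrite natrD => cardE.
  have : #|good s' :&: low_degree eta C B|%:R <= #|low_degree eta C B|%:R :> R.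
    by rewrite ler_nat subset_leq_card // subsetIr.
  rewrite /= -(natr1 (size s')) mulrDl mul1r; clear -IH lB cardE; lra.
have [||c [c' [cg c'g ecc' Hs]]] := rich (good s) s s3.
- have /card_good : {in s, forall B : {set T}, #|low_degree eta C B|%:R <= r}.
    by move=> B /lowB[].
  apply: le_trans; have : (size s)%:R * r <= 3 * r by rewrite ler_wpM2r // (ler_nat _ _ 3).
  by clear -big; lra.
- move=> B Bs; split; first by case: (lowB B Bs).
  by move=> v; rewrite inE => /andP[_ /allP]; apply.
by exists c, c'; split=> //; apply: (subsetP (goodC s)).
Qed.

Lemma set_neq0 (A : {set T}) : A != set0 <-> 0 < #|A|%:R :> R.
Proof. by rewrite ltr0n card_gt0. Qed.

Lemma edge_subset c c' (C : {set T}) : c \in C -> c' \in C -> {subset [:: c; c'] <= C}.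
Proof. by move=> cC c'C x; rewrite !inE => /orP[]/eqP->. Qed.

Lemma pairwise_edge c c' : e c c' -> pairwise e [:: c; c'].
Proof. by move=> /= ->. Qed.

Section K8.
Variables (eta eps sigma : R).
Hypotheses (eps0 : 0 < eps) (eps1 : eps <= 1).
Hypotheses (tri : triangle_rich sigma) (edg : edge_rich eta eps sigma).
(** Below [eps ^+ 2], the smallest proportion to which a set has shrunk when its hereditary density
    is used, and small enough that a set of proportion [eps ^+ 2] can lose [3 * rho] and keep
    [eps ^+ 3 / 2]. *)
Let rho := eps ^+ 3 / 8.

Let rho0 : 0 < rho. Proof. by rewrite divr_gt0 // exprn_gt0. Qed.
Let eps2 : eps ^+ 2 <= eps. Proof. by rewrite ler_iXnr // ltW. Qed.
Let eps3 : eps ^+ 3 <= eps ^+ 2. Proof. by rewrite exprS ler_piMl // exprn_ge0 // ltW. Qed.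
Let eps3_gt0 : 0 < eps ^+ 3. Proof. exact: exprn_gt0. Qed.

Let le_scale (a b : R) (A : {set T}) : a <= b -> a * #|A|%:R <= b * #|A|%:R.
Proof. by move=> ab; rewrite ler_wpM2r. Qed.

(** Edges are taken in [A4], [A3], [A2] in turn, each time restricting the remaining sets to common
    neighbourhoods of proportion at least [eps]; the last edge is found in what remains of [A1]. *)
Lemma clique_of_four_dense (A1 A2 A3 A4 : {set T}) :
  (forall A, A \in [:: A1; A2; A3; A4] -> A != set0 /\ sigma * n <= eps ^+ 3 / 2 * #|A|%:R) ->
  hered_dense rho eta A4 A1 -> hered_dense rho eta A4 A2 -> hered_dense rho eta A4 A3 ->
  hered_dense rho eta A3 A1 -> hered_dense rho eta A3 A2 -> hered_dense rho eta A2 A1 ->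
  has_clique 8 [set: T].
Proof.
move=> big hd41 hd42 hd43 hd31 hd32 hd21.
have [A1n big1] := big A1 ltac:(by rewrite !inE eqxx ?orbT).
have [A2n big2] := big A2 ltac:(by rewrite !inE eqxx ?orbT).
have [A3n big3] := big A3 ltac:(by rewrite !inE eqxx ?orbT).
have [A4n big4] := big A4 ltac:(by rewrite !inE eqxx ?orbT).
have [A1p A2p A3p A4p] : [/\ 0 < #|A1|%:R :> R, 0 < #|A2|%:R :> R, 0 < #|A3|%:R :> R
  & 0 < #|A4|%:R :> R] by split; apply/set_neq0.
have selfdense (A : {set T}) : rho * #|A|%:R <= #|A|%:R.
  by rewrite -[leRHS]mul1r le_scale // /rho; move: eps3 eps2 eps1 eps0; intros; lra.
have [|||||c [c' [cA c'A cc' H1]]] := @edge_step eta eps sigma rho A4 A4 [:: A1; A2; A3] edg.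
- exact: subxx.
- by [].
- exact: ltW.
- move=> B; rewrite !inE => /or3P[]/eqP->; split=> //;
    by [apply: low_degree_small hd41 _ _|apply: low_degree_small hd42 _ _
       |apply: low_degree_small hd43 _ _].
- apply: le_trans (_ : eps ^+ 3 / 2 * #|A4|%:R + 3 * (rho * #|A4|%:R) <= _).
    by rewrite lerD2r.
  rewrite mulrA -mulrDl -[leRHS]mul1r le_scale // /rho; move: eps3 eps2 eps1 eps0; intros; lra.
set s1 := [:: c; c'] in H1.
have s1e : pairwise e s1 by exact: pairwise_edge.
have [G1 G2 G3] : [/\ eps * #|A1|%:R <= #|common_nbr s1 A1|%:R,
    eps * #|A2|%:R <= #|common_nbr s1 A2|%:R & eps * #|A3|%:R <= #|common_nbr s1 A3|%:R].
  by split; apply: H1; rewrite !inE eqxx ?orbT.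
set B1 := common_nbr s1 A1 in G1; set B2 := common_nbr s1 A2 in G2.
set B3 := common_nbr s1 A3 in G3; pose W1 := common_nbr s1 [set: T].
have [S1 S2 S3] : [/\ B1 \subset A1, B2 \subset A2 & B3 \subset A3].
  by split; apply: common_nbr_sub.
have [B1p B2p] : 0 < #|B1|%:R :> R /\ 0 < #|B2|%:R :> R.
  by split; [apply: lt_le_trans G1|apply: lt_le_trans G2]; rewrite mulr_gt0.
have rho_eps : rho <= eps by rewrite /rho; move: eps3 eps2 eps0 eps1; intros; lra.
have [||||d [d' [dA d'A dd' H2]]] := @edge_step eta eps sigma rho A3 B3 [:: B1; B2] edg S3.
- by [].
- exact: ltW.
- move=> B; rewrite !inE => /orP[]/eqP->; split.
  + exact/set_neq0.
  + by apply: low_degree_small hd31 _ _ => //; apply: le_trans G1; apply: le_scale.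
  + exact/set_neq0.
  + by apply: low_degree_small hd32 _ _ => //; apply: le_trans G2; apply: le_scale.
- apply: le_trans G3; apply: le_trans (_ : eps ^+ 3 / 2 * #|A3|%:R + 3 * (rho * #|A3|%:R) <= _).
    by rewrite lerD2r.
  by rewrite mulrA -mulrDl le_scale // /rho; move: eps3 eps2 eps3_gt0 eps1 eps0; intros; lra.
set s2 := [:: d; d'] in H2.
have s2e : pairwise e s2 by exact: pairwise_edge.
have [K1 K2] : eps * #|B1|%:R <= #|common_nbr s2 B1|%:R /\
    eps * #|B2|%:R <= #|common_nbr s2 B2|%:R.
  by split; apply: H2; rewrite !inE eqxx ?orbT.
set C1 := common_nbr s2 B1 in K1; set C2 := common_nbr s2 B2 in K2.
have {}K1 : eps ^+ 2 * #|A1|%:R <= #|C1|%:R.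
  by apply: le_trans K1; rewrite expr2 -mulrA ler_wpM2l // ltW.
have {}K2 : eps ^+ 2 * #|A2|%:R <= #|C2|%:R.
  by apply: le_trans K2; rewrite expr2 -mulrA ler_wpM2l // ltW.
have C1A : C1 \subset A1 by apply: subset_trans S1; apply: common_nbr_sub.
have C2A : C2 \subset A2 by apply: subset_trans S2; apply: common_nbr_sub.
have [||||f [f' [fA f'A ff' H3]]] := @edge_step eta eps sigma rho A2 C2 [:: C1] edg C2A.
- by [].
- exact: ltW.
- move=> B; rewrite !inE => /eqP->; split.
    by apply/set_neq0; apply: lt_le_trans K1; rewrite mulr_gt0 // exprn_gt0.
  apply: low_degree_small hd21 _ _ => //; apply: le_trans K1; apply: le_scale.
  by rewrite /rho; move: eps3 eps3_gt0 eps1 eps0; intros; lra.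
- apply: le_trans K2; apply: le_trans (_ : eps ^+ 3 / 2 * #|A2|%:R + 3 * (rho * #|A2|%:R) <= _).
    by rewrite lerD2r.
  by rewrite mulrA -mulrDl le_scale // /rho; move: eps3 eps3_gt0 eps1 eps0; intros; lra.
set s3 := [:: f; f'] in H3.
(* No density condition is left to meet inside [A1], so a triangle supplies the last edge, one
   vertex being dropped. *)
have /tri D3 : sigma * n <= #|common_nbr s3 C1|%:R.
  apply: le_trans (H3 C1 (mem_head _ _)); apply: le_trans big1 _.
  apply: le_trans (_ : eps * (eps ^+ 2 * #|A1|%:R) <= _); last by rewrite ler_wpM2l // ltW.
  by rewrite mulrA -exprS le_scale //; move: eps3_gt0 eps1 eps0; intros; lra.
have {}D3 : has_clique 2 (common_nbr s3 C1).
  case: D3 => -[|x [|y [|z [|? ?]]]] [] // _ sub /= /andP[/and3P[xy _ _] _].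
  exists [:: x; y]; split=> //=; last by rewrite xy.
  by move=> v vxy; apply: sub; move: vxy; rewrite !inE => /orP[]->; rewrite ?orbT.
pose W2 := common_nbr s2 W1.
have B1W : B1 \subset W1 by apply: common_nbrS; apply: subsetT.
have C1W : C1 \subset W2 by apply: common_nbrS.
have C2W : C2 \subset W2 by do 2!apply: common_nbrS; apply: subsetT.
have B3W : B3 \subset W1 by apply: common_nbrS; apply: subsetT.
apply: (@has_clique_join s1 6) => //.
apply: (@has_clique_join s2 4) => //.
  by apply: edge_subset; apply: (subsetP B3W).
apply: (@has_clique_join s3 2).
- by apply: edge_subset; apply: (subsetP C2W).
- exact: pairwise_edge.
- by apply: has_clique_sub D3; apply: common_nbrS.
Qed.

(** An edge in [A3], then a triangle in [A1] and one in [A2]. The density 17/24 is 3/4 minus the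
    regularity error 1/24; since it exceeds 2/3, three vertices of high degree have many common
    neighbours. *)
Lemma clique_of_three_dense (A1 A2 A3 : {set T}) :
  (forall A, A \in [:: A1; A2; A3] -> A != set0 /\ sigma * n <= eps ^+ 3 / 8 * #|A|%:R) ->
  hered_dense rho eta A3 A1 -> hered_dense rho eta A3 A2 ->
  hered_dense rho (17 / 24) A1 A2 ->
  has_clique 8 [set: T].
Proof.
move=> big hd31 hd32 hd12.
have [A1n big1] := big A1 ltac:(by rewrite !inE eqxx ?orbT).
have [A2n big2] := big A2 ltac:(by rewrite !inE eqxx ?orbT).
have [A3n big3] := big A3 ltac:(by rewrite !inE eqxx ?orbT).
have [A1p A2p A3p] : [/\ 0 < #|A1|%:R :> R, 0 < #|A2|%:R :> R & 0 < #|A3|%:R :> R].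
  by split; apply/set_neq0.
have selfdense (A : {set T}) : rho * #|A|%:R <= #|A|%:R.
  by rewrite -[leRHS]mul1r le_scale // /rho; move: eps3 eps2 eps1 eps0; intros; lra.
have [|||||c [c' [cA c'A cc' H1]]] := @edge_step eta eps sigma rho A3 A3 [:: A1; A2] edg.
- exact: subxx.
- by [].
- exact: ltW.
- move=> B; rewrite !inE => /orP[]/eqP->; split=> //;
    by [apply: low_degree_small hd31 _ _|apply: low_degree_small hd32 _ _].
- apply: le_trans (_ : eps ^+ 3 / 8 * #|A3|%:R + 3 * (rho * #|A3|%:R) <= _).
    by rewrite lerD2r.
  by rewrite mulrA -mulrDl -[leRHS]mul1r le_scale // /rho; move: eps3 eps2 eps1 eps0; intros; lra.
set s1 := [:: c; c'] in H1.
have s1e : pairwise e s1 by exact: pairwise_edge.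
have [G1 G2] : eps * #|A1|%:R <= #|common_nbr s1 A1|%:R /\
    eps * #|A2|%:R <= #|common_nbr s1 A2|%:R.
  by split; apply: H1; rewrite !inE eqxx ?orbT.
set B1 := common_nbr s1 A1 in G1; set B2 := common_nbr s1 A2 in G2.
pose W1 := common_nbr s1 [set: T].
have [S1 S2] : B1 \subset A1 /\ B2 \subset A2.
  by split; apply: common_nbr_sub.
have B1W : B1 \subset W1 by apply: common_nbrS; apply: subsetT.
have B2W : B2 \subset W1 by apply: common_nbrS; apply: subsetT.
have rho_eps : rho <= eps by rewrite /rho; move: eps3 eps2 eps0 eps1; intros; lra.
have low : #|low_degree (17 / 24) A1 B2|%:R <= rho * #|A1|%:R.
  by apply: low_degree_small hd12 _ _ => //; apply: le_trans G2; apply: le_scale.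
pose C1 := B1 :\: low_degree (17 / 24) A1 B2.
have /tri[s2 [s2m s2C s2e]] : sigma * n <= #|C1|%:R.
  have := cardsID (low_degree (17 / 24) A1 B2) B1 => /(congr1 (fun k => k%:R : R)).
  rewrite natrD -/C1 => cardE.
  have le1 : #|B1 :&: low_degree (17 / 24) A1 B2|%:R <= #|low_degree (17 / 24) A1 B2|%:R :> R.
    by rewrite ler_nat subset_leq_card // subsetIr.
  have le2 : (eps ^+ 3 / 8 + rho) * #|A1|%:R <= eps * #|A1|%:R.
    by apply: le_scale; rewrite /rho; move: eps3 eps2 eps3_gt0 eps1 eps0; intros; lra.
  by move: big1 G1 low cardE le1 le2; rewrite mulrDl; intros; lra.
have deg x : x \in s2 -> 17 / 24 * #|B2|%:R <= #|nbr x B2|%:R :> R.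
  move=> /s2C; rewrite in_setD => /andP[+ xB].
  by rewrite inE (subsetP S1 _ xB) /= -leNgt.
(* Each vertex of the triangle misses at most 7/24 of [B2], so the three together leave at least 1/8
   of it. *)
have common : forall s, {subset s <= s2} ->
    #|B2|%:R - (size s)%:R * (7 / 24 * #|B2|%:R) <= #|common_nbr s B2|%:R :> R.
  elim=> [|x s IH] ss; first by rewrite mul0r subr0.
  have {}IH := IH (fun y ys => ss y (@mem_behead _ (x :: s) y ys)).
  have dx := deg x (ss x (mem_head _ _)).
  have -> : common_nbr (x :: s) B2 = common_nbr s B2 :&: nbr x B2.
    apply/setP => y; rewrite in_common_nbr in_setI in_common_nbr [in RHS]nbrP /=.
    by case: (y \in B2) => //=; rewrite andbC.
  apply: le_trans (card_setI_ge (common_nbr_sub s B2) (common_nbr_sub [:: x] B2)).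
  rewrite /= -(natr1 (size s)) mulrDl mul1r.
  by move: IH dx; rewrite /common_nbr /=; intros; lra.
have /tri D : sigma * n <= #|common_nbr s2 B2|%:R.
  apply: le_trans (common s2 (fun x h => h)); rewrite s2m.
  have : (eps ^+ 3) * #|A2|%:R <= eps * #|A2|%:R.
    by apply: le_scale; move: eps3 eps2 eps1 eps0; intros; lra.
  by move: big2 G2; intros; lra.
apply: (@has_clique_join s1 6) => //.
have -> : 6%N = (size s2 + 3)%N by rewrite s2m.
apply: has_clique_join => //.
  by move=> x /s2C; rewrite inE => /andP[_ /(subsetP B1W)].
by apply: has_clique_sub D; apply: common_nbrS.
Qed.

End K8.
End Embedding.

(** * A weighted Turan theorem *)

Section WeightedTuran.
Variables (R : realFieldType) (I : finType) (w : I -> I -> R).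
Hypotheses (w_sym : forall i j, w i j = w j i) (w_diag : forall i, w i i = 0).
Hypotheses (w_ge0 : forall i j, 0 <= w i j) (w_le1 : forall i j, w i j <= 1).
Hypothesis no_K4 : forall i j k l, 0 < w i j -> 0 < w i k -> 0 < w j k ->
  0 < w i l -> 0 < w j l -> 0 < w k l -> False.
Hypothesis light_triangle : forall i j k, 0 < w i j -> 0 < w i k -> 0 < w j k ->
  w i j <= 3 / 4.

Let W (A B : {set I}) : R := \sum_(i in A) \sum_(j in B) w i j.

Let W_sym A B : W A B = W B A.
Proof. by rewrite /W exchange_big; do 2!(apply: eq_bigr => ? _). Qed.

Let W_split (U X : {set I}) : X \subset U ->
  W U U = W X X + 2 * W (U :\: X) X + W (U :\: X) (U :\: X).
Proof.
move=> XU; have E (f : I -> R) : \sum_(i in U) f i = \sum_(i in X) f i + \sum_(i in U :\: X) f i.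
  by rewrite (big_setID X) /= (setIidPr XU).
have E2 (A : {set I}) : W A U = W A X + W A (U :\: X).
  by rewrite /W -big_split; apply: eq_bigr => i _; rewrite E.
rewrite {1}/W E -/(W X U) -/(W (U :\: X) U) !E2 (W_sym X (U :\: X)).
by ring.
Qed.

Let W_le (c : R) (A X : {set I}) : (forall i, i \in A -> \sum_(j in X) w i j <= c) ->
  W A X <= #|A|%:R * c.
Proof. by move=> H; rewrite mulr_natl -sumr_const; apply: ler_sum. Qed.

Let pos_or0 i j : w i j = 0 \/ 0 < w i j.
Proof. by case: (ltgtP 0 (w i j)) (w_ge0 i j) => // [|<-]; [right|left]. Qed.

(** Three positive weights would give a K4. Two positive weights lie in a common triangle, so each
    is at most 3/4; a single one is at most 1. *)
Let triangle_bound x y z i : 0 < w x y -> 0 < w x z -> 0 < w y z ->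
  w i x + w i y + w i z <= 3 / 2.
Proof.
move=> xy xz yz.
have [yx zx zy] : [/\ 0 < w y x, 0 < w z x & 0 < w z y].
  by rewrite (w_sym y x) (w_sym z x) (w_sym z y).
have := w_le1 i x; have := w_le1 i y; have := w_le1 i z.
case: (pos_or0 i x) => ix; case: (pos_or0 i y) => iy; case: (pos_or0 i z) => iz.
- by rewrite ix iy iz; intros; lra.
- by rewrite ix iy; intros; lra.
- by rewrite ix iz; intros; lra.
- have := light_triangle iy iz yz; have := light_triangle iz iy zy.
  by rewrite ix; intros; lra.
- by rewrite iy iz; intros; lra.
- have := light_triangle ix iz xz; have := light_triangle iz ix zx.
  by rewrite iy; intros; lra.
- have := light_triangle ix iy xy; have := light_triangle iy ix yx.
  by rewrite iz; intros; lra.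
- by case: (no_K4 ix iy xy iz xz yz).
Qed.

(* Induction removing a triangle of the support, or an edge if there is none: a
   vertex sends weight at most #|X| / 2 to the removed set X. *)
Lemma weighted_turan (U : {set I}) : W U U <= #|U|%:R ^+ 2 / 2.
Proof.
have [m] := ubnP #|U|; elim: m U => // m IH U lt.
have neq i j : 0 < w i j -> i != j.
  by move=> wij; apply: contraTneq wij => ->; rewrite w_diag ltxx.
have sum2 (f : I -> R) x y : x != y -> \sum_(i in [set x; y]) f i = f x + f y.
  by move=> xy; rewrite big_setU1 ?inE //= big_set1.
have sum3 (f : I -> R) x y z : x != y -> x != z -> y != z ->
    \sum_(i in x |: [set y; z]) f i = f x + f y + f z.
  by move=> xy xz yz; rewrite big_setU1 ?inE ?negb_or ?xy ?xz //= sum2 // addrA.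
have cardD (X : {set I}) : X \subset U -> #|U|%:R = #|U :\: X|%:R + #|X|%:R :> R.
  by move=> XU; rewrite -natrD addnC -(cardsID X U) (setIidPr XU).
have IHD (X : {set I}) x : x \in X -> X \subset U ->
    W (U :\: X) (U :\: X) <= #|U :\: X|%:R ^+ 2 / 2.
  move=> xX XU; apply: IH; move: lt; rewrite ltnS; apply: leq_trans; apply: proper_card.
  rewrite properE subsetDl; apply/subsetPn; exists x; first exact: (subsetP XU).
  by rewrite inE xX.
have [/existsP[x /existsP[y /existsP[z /and4P[xU yU zU /and3P[xy xz yz]]]]]|notri] :=
    boolP [exists x, exists y, exists z, [&& x \in U, y \in U, z \in U &
      [&& 0 < w x y, 0 < w x z & 0 < w y z]]].
  pose X := x |: [set y; z].
  have XU : X \subset U by rewrite subUset sub1set xU subUset !sub1set yU.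
  have cX : #|X| = 3%N.
    by rewrite cardsU1 cards2 !inE negb_or (neq _ _ xy) (neq _ _ xz) (neq _ _ yz).
  have out i : \sum_(j in X) w i j <= 3 / 2.
    by rewrite sum3 ?neq //; apply: triangle_bound.
  have WX : W X X <= #|X|%:R * (3 / 2) by apply: W_le.
  have WD : W (U :\: X) X <= #|U :\: X|%:R * (3 / 2) by apply: W_le.
  have := IHD X x (setU11 _ _) XU.
  rewrite (W_split XU) (cardD X XU); move: WX WD; rewrite cX.
  by set u := #|_|%:R; intros; nra.
have [/existsP[x /existsP[y /and3P[xU yU xy]]]|noedge] :=
    boolP [exists x, exists y, [&& x \in U, y \in U & 0 < w x y]].
  pose X := [set x; y].
  have XU : X \subset U by rewrite subUset !sub1set xU yU.
  have cX : #|X| = 2%N by rewrite cards2 (neq _ _ xy).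
  have out i : i \in U -> \sum_(j in X) w i j <= 1.
    move=> iU; rewrite sum2 ?neq //.
    case: (pos_or0 i x) => ix; first by rewrite ix add0r.
    case: (pos_or0 i y) => iy; first by rewrite iy addr0.
    case/negP: notri; apply/existsP; exists i; apply/existsP; exists x; apply/existsP; exists y.
    by rewrite iU xU yU ix iy xy.
  have WX : W X X <= #|X|%:R * 1 by apply: W_le => i /(subsetP XU); apply: out.
  have WD : W (U :\: X) X <= #|U :\: X|%:R * 1.
    by apply: W_le => i; rewrite inE => /andP[_]; apply: out.
  have := IHD X x (setU11 _ _) XU.
  rewrite (W_split XU) (cardD X XU); move: WX WD; rewrite cX.
  by set u := #|_|%:R; intros; nra.
rewrite /W big1 ?divr_ge0 ?exprn_ge0 // => i iU; apply: big1 => j jU.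
case: (pos_or0 i j) => // ij; case/negP: noedge.
by apply/existsP; exists i; apply/existsP; exists j; rewrite iU jU.
Qed.

End WeightedTuran.

(** * Regular tuples *)

Section Density.
Variables (R : realFieldType) (T : finType) (G : sgraph T).
Local Notation edge_count := (edge_count G).

Lemma edge_count_sym (A B : {set T}) : edge_count A B = edge_count B A.
Proof.
rewrite /edge_count double_count; apply: eq_bigr => b _; apply: eq_card => x.
by rewrite !inE adj_sym.
Qed.

Lemma edge_count_le (A B : {set T}) : (edge_count A B <= #|A| * #|B|)%N.
Proof.
rewrite -sum_nat_const; apply: leq_sum => a _; apply: subset_leq_card.
by apply/subsetP => x; rewrite nbrP => /andP[].
Qed.

Lemma edge_count_split (A B X : {set T}) : X \subset A ->
  edge_count A B = (edge_count X B + edge_count (A :\: X) B)%N.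
Proof. by move=> XA; rewrite /edge_count (big_setID X) /= (setIidPr XA). Qed.

(** Division by zero gives 0 when a set is empty; the edge count is then 0 too, so [density_mul]
    holds for all sets. *)
Definition density (A B : {set T}) : R := (edge_count A B)%:R / (#|A|%:R * #|B|%:R).

Lemma density_sym A B : density A B = density B A.
Proof. by rewrite /density edge_count_sym [_ * #|A|%:R]mulrC. Qed.

Lemma density_mul A B : density A B * (#|A|%:R * #|B|%:R) = (edge_count A B)%:R.
Proof.
have [AB0|AB0] := eqVneq (#|A| * #|B|)%N 0%N; last first.
  by rewrite /density divfK // -natrM pnatr_eq0.
have := edge_count_le A B; rewrite AB0 leqn0 => /eqP E.
by rewrite /density E !mul0r.
Qed.

Lemma density_ge0 A B : 0 <= density A B.
Proof. by rewrite divr_ge0 // mulr_ge0. Qed.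

Lemma density_le1 A B : density A B <= 1.
Proof.
have [AB0|AB0] := posnP (#|A| * #|B|)%N.
  by rewrite /density -natrM AB0 invr0 mulr0 ler01.
by rewrite /density -natrM ler_pdivrMr ?ltr0n // mul1r ler_nat edge_count_le.
Qed.

Lemma density_split (A B X : {set T}) : X \subset A -> A != set0 -> B != set0 ->
  density A B = #|X|%:R / #|A|%:R * density X B + #|A :\: X|%:R / #|A|%:R * density (A :\: X) B.
Proof.
move=> XA A0 B0.
have a0 : #|A|%:R != 0 :> R by rewrite pnatr_eq0 cards_eq0.
have b0 : #|B|%:R != 0 :> R by rewrite pnatr_eq0 cards_eq0.
apply: (mulIf (mulf_neq0 a0 b0)); rewrite density_mul (edge_count_split B XA) natrD.
by rewrite -!density_mul; field.
Qed.

End Density.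

Section RegularTuple.
Variables (R : realFieldType) (T : finType) (G : sgraph T) (I : finType) (tau : R).
Hypothesis tau0 : 0 < tau.
Local Notation tuple := {ffun I -> {set T}}.
Local Notation d := (density R G).

Definition phi (x : R) : R := x + tau * x ^+ 2.

(* The linear part keeps the total density from dropping; the small quadratic
   part makes the potential strictly convex, which forces regularity. *)
Definition potential (A : tuple) : R :=
  \sum_i \sum_(j | j != i) phi (d (A i) (A j)).

Definition update (A : tuple) (i : I) (X : {set T}) : tuple :=
  [ffun j => if j == i then X else A j].

(** The near-maximality from which regularity is deduced: all sets may be shrunk at once, each
    keeping a proportion [mu]. *)
Definition stable (mu eps : R) (A : tuple) : Prop :=
  forall A' : tuple, (forall i, A' i \subset A i) ->
    (forall i, mu * #|A i|%:R <= #|A' i|%:R) -> potential A' <= potential A + eps.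

Let K : R := #|I|%:R ^+ 2 * (1 + tau).

Lemma phi_ge0 x : 0 <= x -> 0 <= phi x.
Proof. by move=> x0; rewrite addr_ge0 // mulr_ge0 ?exprn_ge0 // ltW. Qed.

Lemma potential_ge0 A : 0 <= potential A.
Proof. by do 2!apply: sumr_ge0 => ? _; apply: phi_ge0; apply: density_ge0. Qed.

Lemma potential_le A : potential A <= K.
Proof.
have -> : K = \sum_(i : I) \sum_(j : I) (1 + tau).
  by rewrite !sumr_const -mulrnA -mulr_natl natrM /K expr2.
apply: ler_sum => i _; rewrite [leRHS](bigID (fun j => j != i)) /= -[leLHS]addr0.
have t1 : 0 <= 1 + tau by rewrite addr_ge0 // ltW.
apply: lerD; last by apply: sumr_ge0.
apply: ler_sum => j _; rewrite /phi lerD ?density_le1 //.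
by rewrite -[leRHS]mulr1 ler_wpM2l ?(ltW tau0) // exprn_ile1 ?density_ge0 ?density_le1.
Qed.

(** Every failure of stability raises the potential by more than [eps] while shrinking the sets by
    at most a factor [mu]. As the potential never exceeds [K], this happens fewer than [M] times. *)
Lemma exists_stable (mu eps : R) (M : nat) (A0 : tuple) :
  0 < mu -> mu <= 1 -> K - potential A0 < M%:R * eps ->
  exists A : tuple, [/\ forall i, mu ^+ M * #|A0 i|%:R <= #|A i|%:R,
     potential A0 <= potential A & stable mu eps A].
Proof.
move=> mu0 mu1; elim: M A0 => [|M IH] A0 lt.
  by move: lt; rewrite mul0r subr_lt0 ltNge potential_le.
have [/existsP[A' /andP[/forallP sub big]]|no] := boolP [exists A' : tuple,
   [forall i, (A' i \subset A0 i) && (mu * #|A0 i|%:R <= #|A' i|%:R)]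
     && (potential A0 + eps < potential A')].
  have [|A [szA leA stA]] := IH A'.
    by move: lt; rewrite -natr1 mulrDl mul1r; move: big; clear; intros; lra.
  (* The sign of [eps] is not given; a negative one contradicts the hypothesis on [K]. *)
  have leA0 : potential A0 <= potential A' \/ eps < 0.
    by case: (leP 0 eps) => e0; [left; lra|right].
  case: leA0 => [leA0|neg]; last first.
    have := potential_le A0; move: lt; have : M.+1%:R * eps <= 0.
      by rewrite mulr_ge0_le0 // ltW.
    by clear; intros; lra.
  exists A; split=> //; last exact: le_trans leA.
  move=> i; apply: le_trans (szA i); rewrite exprSr -mulrA ler_wpM2l ?exprn_ge0 ?(ltW mu0) //.
  by have /andP[] := sub i.
exists A0; split=> // [i|A' sub sz].
  by rewrite ler_piMl // exprn_ile1 // ltW.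
rewrite leNgt; apply/negP => lt'; case/negP: no; apply/existsP; exists A'.
by rewrite lt' andbT; apply/forallP => i; rewrite sub sz.
Qed.

Let rest (A : tuple) (i : I) : R :=
  \sum_(a | a != i) \sum_(b | (b != a) && (b != i)) phi (d (A a) (A b)).

Let potential_split A i :
  potential A = 2 * \sum_(j | j != i) phi (d (A i) (A j)) + rest A i.
Proof.
rewrite /potential (bigD1 i) //= mulr2n mulrDl mul1r -addrA; congr (_ + _).
rewrite /rest -big_split; apply: eq_bigr => a ai /=.
by rewrite (bigD1 i) 1?eq_sym //= density_sym.
Qed.

Let potential_update A i X :
  potential (update A i X) = 2 * \sum_(j | j != i) phi (d X (A j)) + rest A i.
Proof.
rewrite (potential_split _ i); congr (2 * _ + _).
  by apply: eq_bigr => j ji; rewrite !ffunE eqxx (negbTE ji).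
apply: eq_bigr => a ai; apply: eq_bigr => b /andP[_ bi].
by rewrite !ffunE (negbTE ai) (negbTE bi).
Qed.

(** The linear part of [phi] cancels and the right side is exactly [tau] times the variance, of
    which only the term of [x] is kept. *)
Let phi_convex (p q x y : R) : 0 <= p -> 0 <= q -> p + q = 1 ->
  tau * p * (x - (p * x + q * y)) ^+ 2 <= p * phi x + q * phi y - phi (p * x + q * y).
Proof.
move=> p0 q0 pq; have -> : q = 1 - p by rewrite -pq addrC addKr.
have q0' : 0 <= 1 - p by rewrite -pq addrC addKr.
rewrite -subr_ge0 (_ : _ - _ = tau * ((1 - p) * (y - (p * x + (1 - p) * y)) ^+ 2)).
  by rewrite mulr_ge0 ?(ltW tau0) // mulr_ge0 // sqr_ge0.
by rewrite /phi; ring.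
Qed.

(** Densities to [A j] average over the two parts of [A i], so by convexity every [j] contributes
    nonnegatively to the right side, and [l] contributes its variance. The factor 2 comes from
    ordered pairs. *)
Lemma potential_convex (A : tuple) i l (X : {set T}) : (forall j, A j != set0) -> X \subset A i -> l != i ->
  2 * tau * (#|X|%:R / #|A i|%:R) * (d X (A l) - d (A i) (A l)) ^+ 2 <=
  #|X|%:R / #|A i|%:R * (potential (update A i X) - potential A)
  + #|A i :\: X|%:R / #|A i|%:R * (potential (update A i (A i :\: X)) - potential A).
Proof.
move=> A0 XA li; set p := #|X|%:R / _; set q := #|_ :\: _|%:R / _.
have a0 : #|A i|%:R != 0 :> R by rewrite pnatr_eq0 cards_eq0.
have p0 : 0 <= p by rewrite divr_ge0.
have q0 : 0 <= q by rewrite divr_ge0.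
have pq : p + q = 1.
  apply: (mulIf a0); rewrite /p /q mulrDl !divfK // mul1r -natrD.
  by rewrite -[in RHS](cardsID X (A i)) (setIidPr XA).
pose gap j := p * phi (d X (A j)) + q * phi (d (A i :\: X) (A j)) - phi (d (A i) (A j)).
have gap_ge j : tau * p * (d X (A j) - d (A i) (A j)) ^+ 2 <= gap j.
  by rewrite /gap (density_split R G XA (A0 i) (A0 j)); apply: phi_convex.
have gap0 j : 0 <= gap j.
  by apply: le_trans (gap_ge j); rewrite mulr_ge0 ?sqr_ge0 // mulr_ge0 // ltW.
have -> : p * (potential (update A i X) - potential A)
    + q * (potential (update A i (A i :\: X)) - potential A) = 2 * \sum_(j | j != i) gap j.
  have -> : \sum_(j | j != i) gap j = p * \sum_(j | j != i) phi (d X (A j))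
      + q * \sum_(j | j != i) phi (d (A i :\: X) (A j)) - \sum_(j | j != i) phi (d (A i) (A j)).
    by rewrite /gap sumrB; congr (_ - _); rewrite !mulr_sumr -big_split.
  rewrite !potential_update (potential_split A i).
  have -> : q = 1 - p by rewrite -pq addrC addKr.
  by ring.
apply: le_trans (_ : 2 * gap l <= _).
  by have := gap_ge l; set D := _ ^+ 2; clear; intros; lra.
by rewrite ler_wpM2l // (bigD1 l) //= lerDl sumr_ge0.
Qed.

(** The weighted gains of the two parts are each at most [eps], yet their sum dominates the
    variance: so the deviation is small. As the sum is nonnegative, neither gain is very negative;
    this second conclusion lets the step be repeated on the updated tuple. *)
Lemma stable_step (mu rho eps : R) (A : tuple) i l (X : {set T}) : (forall j, A j != set0) ->
  0 < mu -> mu <= rho -> 0 <= eps -> mu * K <= eps ->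
  (forall Y : {set T}, Y \subset A i -> mu * #|A i|%:R <= #|Y|%:R ->
     potential (update A i Y) <= potential A + eps) ->
  X \subset A i -> rho * #|A i|%:R <= #|X|%:R -> l != i ->
  (d X (A l) - d (A i) (A l)) ^+ 2 <= eps / (tau * rho) /\
  potential A - eps / rho <= potential (update A i X).
Proof.
move=> A0 mu0 mur eps0 muK up XA bX li.
have a0 : 0 < #|A i|%:R :> R by rewrite ltr0n card_gt0.
have rho0 : 0 < rho by exact: lt_le_trans mur.
have := potential_convex A0 XA li.
set p := #|X|%:R / _; set q := #|_ :\: _|%:R / _; set dev := (_ - _) ^+ 2.
have rp : rho <= p by rewrite ler_pdivlMr.
have p1 : p <= 1 by rewrite ler_pdivrMr // mul1r ler_nat subset_leq_card.
have q0 : 0 <= q by rewrite divr_ge0.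
have q1 : q <= 1 by rewrite ler_pdivrMr // mul1r ler_nat subset_leq_card // subsetDl.
have dev0 : 0 <= dev by rewrite sqr_ge0.
have upX : potential (update A i X) <= potential A + eps.
  by apply: up => //; apply: le_trans bX; rewrite ler_wpM2r.
have upY : q * (potential (update A i (A i :\: X)) - potential A) <= eps.
  (* A complement below proportion [mu] escapes the near-maximality; its weight is then so small
     that its gain is at most [mu * K]. *)
  have [muq|qmu] := leP mu q.
    have := up (A i :\: X) (subsetDl _ _); rewrite -ler_pdivlMr // => /(_ muq) upY.
    have : q * (potential (update A i (A i :\: X)) - potential A) <= q * eps.
      by rewrite ler_wpM2l // lerBlDl.
    by move/le_trans; apply; rewrite ler_piMl.
  apply: le_trans muK; apply: le_trans (_ : q * K <= _).
    by rewrite ler_wpM2l // lerBlDl; apply: le_trans (potential_le _) _; rewrite lerDr potential_ge0.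
  by rewrite ler_wpM2r ?(ltW qmu) // mulr_ge0 ?exprn_ge0 // addr_ge0 // ltW.
move: upX upY; set FX := potential (update A i X); set FY := q * _; set F := potential A.
move=> upX upY H; split.
  rewrite ler_pdivlMr ?mulr_gt0 //.
  have h1 : tau * dev * rho <= tau * dev * p by rewrite ler_wpM2l // mulr_ge0 // ltW.
  have h2 : p * (FX - F) <= eps.
    apply: le_trans (_ : p * eps <= _); last by rewrite ler_piMl.
    by rewrite ler_wpM2l ?lerBlDl // (le_trans (ltW rho0)).
  have -> : dev * (tau * rho) = tau * dev * rho by ring.
  by move: h1 h2 H upY; clear; intros; lra.
have h3 : 0 <= 2 * tau * p * dev.
  have p0 : 0 <= p by rewrite (le_trans (ltW rho0)).
  by rewrite mulr_ge0 // mulr_ge0 // mulr_ge0 // ltW.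
have h4 : - eps <= p * (FX - F) by move: h3 H upY; clear; intros; lra.
rewrite lerBlDr -lerBlDl ler_pdivlMr //.
have [FF|FF] := leP F FX.
  by apply: le_trans eps0; rewrite mulr_le0_ge0 ?subr_le0 // ltW.
apply: le_trans (_ : (F - FX) * p <= _).
  by rewrite ler_wpM2l // subr_ge0 ltW.
by move: h4; clear; intros; lra.
Qed.

(** Replace [A i] by [X], then [A j] by [Y]. The first replacement lowers the potential by at most
    [eps / rho], so the second step runs with [eps + eps / rho] in place of [eps]. Each deviation is
    at most [eta]. *)
Lemma stable_regular (mu rho eps eta : R) (A : tuple) : (forall j, A j != set0) ->
  0 < mu -> mu <= rho -> rho <= 1 -> 0 <= eps -> mu * K <= eps -> 0 <= eta ->
  eps * (1 + rho^-1) / (tau * rho) <= eta ^+ 2 ->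
  stable mu eps A ->
  forall i j (X Y : {set T}), j != i -> X \subset A i -> Y \subset A j ->
    rho * #|A i|%:R <= #|X|%:R -> rho * #|A j|%:R <= #|Y|%:R ->
    `|d X Y - d (A i) (A j)| <= 2 * eta.
Proof.
move=> A0 mu0 mur rho1 eps0 muK eta0 small st i j X Y ji XA YA bX bY.
have rho0 : 0 < rho by exact: lt_le_trans mur.
have r1 : 0 < rho^-1 by rewrite invr_gt0.
have tr0 : 0 < (tau * rho)^-1 by rewrite invr_gt0 mulr_gt0.
have mu1 (Z : {set T}) : mu * #|Z|%:R <= #|Z|%:R.
  by rewrite ler_piMl // (le_trans mur).
have upd (B : tuple) l (Z : {set T}) : (forall m, B m \subset A m) ->
    (forall m, mu * #|A m|%:R <= #|B m|%:R) ->
    Z \subset A l -> mu * #|A l|%:R <= #|Z|%:R -> potential (update B l Z) <= potential A + eps.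
  move=> BA Bb ZA Zb; apply: st => m; rewrite ffunE; case: eqP => [->//|_]; [exact: BA|exact: Bb].
have [|dev1 low1] := stable_step A0 mu0 mur eps0 muK _ XA bX ji.
  by move=> Z ZA Zb; apply: upd.
pose A1 := update A i X.
have A1i : A1 i = X by rewrite ffunE eqxx.
have A1j : A1 j = A j by rewrite ffunE (negbTE ji).
have A10 m : A1 m != set0.
  have X0 : X != set0.
    rewrite -card_gt0 -(ltr0n R); apply: lt_le_trans bX.
    by rewrite mulr_gt0 // ltr0n card_gt0.
  by rewrite ffunE; case: (m =P i).
have muX : mu * #|A i|%:R <= #|X|%:R by apply: le_trans bX; rewrite ler_wpM2r.
have A1A m : A1 m \subset A m by rewrite ffunE; case: eqP => // ->.
have A1b m : mu * #|A m|%:R <= #|A1 m|%:R by rewrite ffunE; case: eqP => // ->.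
set e1 := eps * (1 + rho^-1) in small.
have e1E : e1 = eps + eps / rho by rewrite /e1; ring.
have er0 : 0 <= eps / rho by rewrite mulr_ge0 // ltW.
have ij : i != j by rewrite eq_sym.
have [|||||dev2 _] := @stable_step mu rho e1 A1 j i Y A10 mu0 mur _ _ _ _ _ ij.
- by rewrite e1E addr_ge0.
- by apply: le_trans muK _; rewrite e1E lerDl.
- move=> Z; rewrite A1j => ZA Zb; apply: le_trans (upd A1 j Z A1A A1b ZA Zb) _.
  by rewrite e1E; move: low1; rewrite -/A1; clear; intros; lra.
- by rewrite A1j.
- by rewrite A1j.
move: dev2; rewrite A1i A1j !(density_sym R G _ X) => dev2.
have sq (x : R) : x ^+ 2 <= eta ^+ 2 -> `|x| <= eta.
  by move=> h; rewrite -(ler_pXn2r (n := 2)) ?nnegrE // real_normK ?num_real.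
have /sq h1 : (d X (A j) - d (A i) (A j)) ^+ 2 <= eta ^+ 2.
  apply: le_trans small; apply: le_trans dev1 _.
  by rewrite ler_pM2r // e1E lerDl.
have /sq h2 : (d X Y - d X (A j)) ^+ 2 <= eta ^+ 2 by apply: le_trans small.
rewrite -(subrKA (d X (A j))); apply: le_trans (ler_normD _ _) _.
by move: h1 h2; clear; intros; lra.
Qed.

End RegularTuple.

(** * The edge bound for rich graphs without a clique on 8 vertices *)

(** Each edge is the image of the two distinct ordered pairs [(x, y)] and [(y, x)]. *)
Lemma num_edges_le (T : finType) (G : sgraph T) :
  (2 * num_edges G <= edge_count G setT setT)%N.
Proof.
pose P := [set p : T * T | adj G p.1 p.2].
have -> : edge_count G setT setT = #|P|.
  rewrite /edge_count -[RHS]sum1_card (eq_bigl (fun p => adj G p.1 p.2)); last first.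
    by move=> p; rewrite inE.
  rewrite -(pair_big_dep predT (fun x y => adj G x y) (fun _ _ => 1%N)) /=.
  apply: eq_big => [x|x _]; first by rewrite inE.
  by rewrite -sum1_card; apply: eq_bigl => y; rewrite !inE.
pose f (p : T * T) := [set p.1; p.2].
have fE p : p \in P -> f p \in edges G.
  by rewrite inE => pP; apply: imset_f; rewrite inE.
rewrite -[leqRHS]sum1_card (partition_big f (mem (edges G))) //= mulnC -sum_nat_const.
apply: leq_sum => E /imsetP[[x y]]; rewrite inE /= => xy ->.
have xy' : (x, y) != (y, x).
  by apply: contraTneq xy => -[-> _]; rewrite adj_irrefl.
rewrite (bigD1 (x, y)) /=; last by rewrite inE /= xy eqxx.
rewrite (bigD1 (y, x)) /=; last by rewrite inE /= adj_sym xy /f /= setUC eqxx eq_sym.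
by [].
Qed.

Lemma few_edges_of_rich (R : archiRealFieldType) (gamma eps : R) :
  0 < gamma -> 0 < eps -> eps <= 1 ->
  exists2 sigma : R, 0 < sigma & forall (T : finType) (G : sgraph T),
    (0 < #|T|)%N -> triangle_rich G sigma -> edge_rich G (gamma / 8) eps sigma ->
    ~ has_clique G 8 [set: T] ->
    (num_edges G)%:R <= #|T|%:R ^+ 2 / 4 + gamma * #|T|%:R ^+ 2.
Proof.
move=> g0 e0 e1.
(* Turan bounds the weight by k^2 / 2, but only k * (k - 1) ordered pairs contribute; this [k] makes
   the surplus of order [gamma] outweigh the missing diagonal. *)
pose k := Num.bound (2 + gamma^-1).
have gi0 : 0 < gamma^-1 by rewrite invr_gt0.
have kbig : 2 + gamma^-1 < k%:R.
  by apply: archi_boundP; apply: addr_ge0 => //; apply: ltW.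
pose rho := eps ^+ 3 / 8.
have eps3 : 0 < eps ^+ 3 by rewrite exprn_gt0.
have rho0 : 0 < rho by rewrite divr_gt0.
have rho1 : rho <= 1.
  by have := exprn_ile1 3 (ltW e0) e1; rewrite /rho; intros; lra.
(* Densities drop by at most [2 * zeta] on large subsets: at most [gamma / 8] brings 2 * eta down to
   eta, at most 1/24 brings 3/4 down to 17/24. *)
pose zeta := Num.min (gamma / 16) (1 / 48).
have zeta0 : 0 < zeta by rewrite lt_min; apply/andP; split; lra.
have zeta1 : zeta <= gamma / 16 by rewrite ge_min lexx.
have zeta2 : zeta <= 1 / 48 by rewrite ge_min lexx orbT.
have ri0 : 0 < 1 + rho^-1 by rewrite addr_gt0 ?invr_gt0.
(* Solves the smallness condition of [stable_regular] with equality, for [tau = gamma]. *)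
pose e := zeta ^+ 2 * (gamma * rho) / (1 + rho^-1).
have ep0 : 0 < e by rewrite divr_gt0 // mulr_gt0 ?exprn_gt0 // mulr_gt0.
pose K : R := #|'I_k|%:R ^+ 2 * (1 + gamma).
have k0 : 0 < k%:R :> R by apply: lt_trans kbig; lra.
have K0 : 0 < K by rewrite /K card_ord mulr_gt0 ?exprn_gt0 // addr_gt0.
pose mu := Num.min rho (e / K).
have mu0 : 0 < mu by rewrite lt_min rho0 divr_gt0.
have mur : mu <= rho by rewrite ge_min lexx.
have muK : mu * K <= e by rewrite -ler_pdivlMr // ge_min lexx orbT.
pose M := Num.bound (K / e).
have MK : K < M%:R * e.
  by rewrite -ltr_pdivrMr //; apply: archi_boundP; apply: divr_ge0; apply: ltW.
(* The stable sets have at least [mu ^+ M * n] vertices; [eps ^+ 3 / 8] is the further loss allowed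
   in the embeddings. *)
pose sigma := eps ^+ 3 / 8 * mu ^+ M.
have sigma0 : 0 < sigma by rewrite mulr_gt0 ?exprn_gt0.
exists sigma => // T G T0 tri edg noK8.
set n : R := #|T|%:R.
have n0 : 0 < n by rewrite ltr0n.
pose D : R := density R G setT setT.
have DE : D * n ^+ 2 = (edge_count G setT setT)%:R.
  by rewrite -(density_mul R) cardsT expr2.
have : 2 * (num_edges G)%:R <= D * n ^+ 2.
  by rewrite DE -natrM ler_nat num_edges_le.
suff DU : D <= 1 / 2 + 2 * gamma.
  have : D * n ^+ 2 <= (1 / 2 + 2 * gamma) * n ^+ 2 by rewrite ler_wpM2r // exprn_ge0 // ltW.
  by set n2 := n ^+ 2; clear; intros; lra.
rewrite leNgt; apply/negP => Dbig.
pose A0 : {ffun 'I_k -> {set T}} := [ffun=> setT].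
have [|||A [szA potA stA]] := @exists_stable R T G 'I_k gamma g0 mu e M A0.
- exact: mu0.
- exact: le_trans mur rho1.
- apply: le_lt_trans MK; rewrite -/K gerBl; exact: potential_ge0.
have cA i : mu ^+ M * n <= #|A i|%:R by have := szA i; rewrite ffunE cardsT.
have A_neq0 i : A i != set0.
  rewrite -card_gt0 -(ltr0n R); apply: lt_le_trans (cA i).
  by rewrite mulr_gt0 // exprn_gt0.
have small : e * (1 + rho^-1) / (gamma * rho) <= zeta ^+ 2.
  rewrite /e divfK ?gt_eqF //.
  by rewrite mulfK // mulf_neq0 // gt_eqF.
have reg := stable_regular g0 A_neq0 mu0 mur rho1 (ltW ep0) muK (ltW zeta0) small stA.
pose v i j := density R G (A i) (A j).
have hd r i j : i != j -> r + 2 * zeta <= v i j -> hered_dense G rho r (A i) (A j).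
  move=> ij rv A' B' AA BB bA bB; rewrite -density_mul ler_wpM2r ?mulr_ge0 //.
  have := reg i j A' B'; rewrite eq_sym => /(_ ij AA BB bA bB).
  by rewrite ler_norml -/(v i j) => /andP[+ _]; move: rv; clear; intros; lra.
have big (B : {set T}) : (exists i, B = A i) ->
    B != set0 /\ sigma * n <= eps ^+ 3 / 8 * #|B|%:R.
  case=> i ->; split; first exact: A_neq0.
  by rewrite /sigma -mulrA ler_wpM2l // divr_ge0 // ltW.
pose eta := gamma / 8.
(* With sparse pairs erased, a positive weight certifies hereditary density [eta]. The diagonal is
   erased as well, since regularity concerns distinct indices only. *)
pose w i j : R := if (i == j) || (v i j < 2 * eta) then 0 else v i j.
have wP i j : 0 < w i j -> [/\ i != j, 2 * eta <= v i j & w i j = v i j].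
  rewrite /w; case: eqVneq => /= [_|ij]; first by rewrite ltxx.
  by case: (ltP (v i j)) => // _; rewrite ltxx.
have vsym i j : v i j = v j i by rewrite /v density_sym.
have wsym i j : w i j = w j i by rewrite /w eq_sym vsym.
have v0 i j : 0 <= v i j by exact: density_ge0.
have v1 i j : v i j <= 1 by exact: density_le1.
have w0 i j : 0 <= w i j by rewrite /w; case: ifP.
have w1 i j : w i j <= 1 by rewrite /w; case: ifP.
have wdiag i : w i i = 0 by rewrite /w eqxx.
have whd i j : 0 < w i j -> hered_dense G rho eta (A j) (A i).
  rewrite wsym => /wP[ij le _]; apply: hd => //; apply: le_trans le.
  by move: zeta1; rewrite /eta; clear; intros; lra.
have noK4 i j l m : 0 < w i j -> 0 < w i l -> 0 < w j l ->
    0 < w i m -> 0 < w j m -> 0 < w l m -> False.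
  move=> ij il jl im jm lm; apply: noK8.
  apply: (clique_of_four_dense e0 e1 tri edg (A1 := A i) (A2 := A j) (A3 := A l) (A4 := A m));
    try exact: whd.
  move=> B BA; have [|Bn sz] := big B.
    by move: BA; rewrite !inE => /or4P[]/eqP->; [exists i|exists j|exists l|exists m].
  split=> //; apply: le_trans sz _; rewrite ler_wpM2r //.
  by move: eps3; clear; intros; lra.
have light i j l : 0 < w i j -> 0 < w i l -> 0 < w j l -> w i j <= 3 / 4.
  move=> ij il jl; rewrite leNgt; apply/negP => heavy; apply: noK8.
  apply: (clique_of_three_dense e0 e1 tri edg (A1 := A i) (A2 := A j) (A3 := A l));
    try exact: whd.
    move=> B BA; apply: big.
    by move: BA; rewrite !inE => /or3P[]/eqP->; [exists i|exists j|exists l].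
  have [neq _ wv] := wP _ _ ij; apply: hd => //; rewrite -wv.
  by move: heavy zeta2; clear; intros; lra.
have := weighted_turan wsym wdiag w0 w1 noK4 light [set: 'I_k].
rewrite cardsT card_ord leNgt => /negP[].
have sumw : \sum_(i in [set: 'I_k]) \sum_(j in [set: 'I_k]) w i j
    = \sum_(i < k) \sum_(j < k | j != i) w i j.
  apply: eq_big => [i|i _]; first by rewrite inE.
  rewrite (bigD1 i) ?inE //= wdiag add0r; apply: eq_bigl => j.
  by rewrite inE.
have cnt (c : R) : \sum_(i < k) \sum_(j < k | j != i) c = k%:R * (k%:R - 1) * c.
  have E i : \sum_(j < k | j != i) c = (k%:R - 1) * c.
    have : \sum_(j < k) c = c + \sum_(j < k | j != i) c by rewrite (bigD1 i).
    by rewrite sumr_const card_ord -[X in X = _]mulr_natl; intros; lra.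
  by rewrite (eq_bigr _ (fun i _ => E i)) sumr_const card_ord -[LHS]mulr_natl mulrA.
(* Per pair, the quadratic term costs at most [gamma] and erasing sparse pairs at most
   [2 * eta = gamma / 4]. Of the excess [2 * gamma] over 1/2, this leaves [3 / 4 * gamma]. *)
have lb : potential G gamma A - k%:R * (k%:R - 1) * (gamma + 2 * eta) <=
    \sum_(i < k) \sum_(j < k | j != i) w i j.
  rewrite -cnt /potential -sumrB; apply: ler_sum => i _; rewrite -sumrB; apply: ler_sum => j ji.
  have vv : gamma * v i j ^+ 2 <= gamma.
    by rewrite -[leRHS]mulr1 ler_wpM2l ?(ltW g0) // exprn_ile1.
  have wv : v i j - 2 * eta <= w i j.
    rewrite /w eq_sym (negbTE ji) /=; case: ltP => [lt|_].
      by rewrite subr_le0 ltW.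
    by rewrite gerBl mulr_ge0 // divr_ge0 // ltW.
  by rewrite /phi -/(v i j); move: vv wv; clear; intros; lra.
have pot0 : k%:R * (k%:R - 1) * D <= potential G gamma A0.
  rewrite -cnt; apply: ler_sum => i _; apply: ler_sum => j _.
  by rewrite !ffunE /phi -/D lerDl mulr_ge0 ?exprn_ge0 ?density_ge0 // ltW.
rewrite sumw; apply: lt_le_trans lb; apply: lt_le_trans (lerB potA (lexx _)).
apply: lt_le_trans (lerB pot0 (lexx _)); rewrite -mulrBr.
have gk : 2 * gamma + 1 < gamma * k%:R.
  by have := kbig; rewrite -(ltr_pM2l g0) mulrDr divff ?gt_eqF // [gamma * 2]mulrC.
apply: lt_trans (_ : k%:R * (k%:R - 1) * (1 / 2 + 3 / 4 * gamma) < _).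
  have -> : k%:R ^+ 2 / 2 = k%:R * (k%:R / 2) :> R by rewrite expr2 mulrA.
  rewrite -mulrA ltr_pM2l //; move: gk g0; clear; set x := gamma * _ => gk g0.
  have -> : (k%:R - 1) * (1 / 2 + 3 / 4 * gamma) = k%:R / 2 - 1 / 2 - 3 / 4 * gamma + 3 / 4 * x.
    by rewrite /x; field.
  by lra.
rewrite ltr_pM2l; first by move: Dbig; rewrite /eta; clear; intros; lra.
by rewrite mulr_gt0 // subr_gt0; move: kbig gi0; clear; intros; lra.
Qed.

(** * From the independence number to richness *)

Section Rich.
Variables (R : realFieldType) (T : finType) (G : sgraph T) (sigma : R) (L : nat).
Local Notation n := (#|T|).
Local Notation alpha := (independence_number G).
Hypotheses (sigma0 : 0 < sigma) (Ln : (2 ^ L <= n)%N) (nL : (n < 2 ^ L.+1)%N).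

(** Apply [triangle_free_bound] with [l] about (log n) / 8 and [D] the larger of alpha and 2^(L/2).
    The latter is at most sqrt n and meets the condition on [D]. If it is the maximum, the bound is
    [2 * n], otherwise [2 * alpha ^ 2]; both are too small. *)
Lemma triangle_rich_of_alpha : (16 <= L)%N -> 2 < sigma * (L %/ 8)%:R ->
  64 * (alpha%:R ^+ 2) < sigma * (n%:R * L.+1%:R) -> triangle_rich G sigma.
Proof.
move=> L16 sL asmall S Sbig.
have [/existsP[x /existsP[y /existsP[z /and3P[xS yS /and4P[zS xy yz xz]]]]]|notri] :=
    boolP [exists x, exists y, exists z, [&& x \in S, y \in S &
       [&& z \in S, adj G x y, adj G y z & adj G x z]]].
  exists [:: x; y; z]; split=> //=; last by rewrite xy xz yz.
  by move=> u; rewrite !inE => /or3P[]/eqP->.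
have S_tfree : {in S & &, forall x y z, adj G x y -> adj G y z -> adj G x z -> False}.
  move=> x y z xS yS zS xy yz xz; case/negP: notri.
  by apply/existsP; exists x; apply/existsP; exists y; apply/existsP; exists z;
     rewrite xS yS zS xy yz xz.
pose l := (L %/ 8)%N; pose m := (2 ^ (L %/ 2))%N.
have lm : (l * (4 ^ l).+1 <= m)%N.
  have h1 : (l < 2 ^ l)%N by apply: ltn_expl.
  have h2 : (4 ^ l = 2 ^ l * 2 ^ l)%N by rewrite -expnMn.
  have h3 : (2 ^ l * (2 ^ l * 2 ^ l) * 2 <= m)%N.
    rewrite -!expnD -expnSr leq_exp2l // /l; lia.
  by rewrite h2; nia.
have mm : (m * m <= n)%N.
  apply: leq_trans Ln; rewrite -expnD leq_exp2l //; lia.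
have := triangle_free_bound S_tfree (D := maxn alpha m) (leq_trans lm (leq_maxr _ _))
  (leq_maxl _ _).
have n0 : 0 < n%:R :> R by rewrite ltr0n; apply: leq_trans Ln; rewrite expn_gt0.
have SL : sigma * n%:R * l%:R <= #|S|%:R * l%:R by rewrite ler_wpM2r.
have l16 : L.+1%:R <= 16 * l%:R :> R by rewrite -natrM ler_nat /l; move: L16; clear; lia.
have [am|ma] := leqP alpha m.
  move=> bound; have : (#|S| * l <= 2 * n)%N.
    apply: leq_trans bound _; rewrite -mulnA leq_mul2l /=.
    by apply: leq_trans mm; rewrite leq_mul2l am orbT.
  rewrite -(ler_nat R) !natrM => bound'; exfalso.
  have : 2 * n%:R < sigma * l%:R * n%:R by rewrite ltr_pM2r.
  by move: SL bound'; intros; lra.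
rewrite -(ler_nat R) !natrM => bound; exfalso.
have : sigma * (n%:R * L.+1%:R) <= 16 * (sigma * n%:R * l%:R).
  have -> : 16 * (sigma * n%:R * l%:R) = sigma * (n%:R * (16 * l%:R)) by ring.
  by rewrite ler_wpM2l ?(ltW sigma0) // ler_wpM2l // ltW.
have := sqr_ge0 (alpha%:R : R).
by move: SL bound asmall; rewrite expr2; intros; lra.
Qed.

Lemma expn2_ge_sqr m : (m.+1 ^ 2 <= 4 * 2 ^ m)%N.
Proof.
elim: m => // -[|[|m]] // IH; rewrite (expnS _ m.+2).
by move: IH; rewrite -!mulnn; set x := (2 ^ m.+2)%N; lia.
Qed.

Variables (eta : R) (h : nat).
Hypotheses (eta0 : 0 < eta) (eta1 : eta <= 1) (h0 : (0 < h)%N) (hE : (2 ^+ h)^-1 <= eta).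

(** Three cleanings leave at least [X] vertices, and [X] exceeds alpha, so the surviving set spans
    an edge; every pair in it has large common neighbourhoods. *)
Lemma edge_rich_of_alpha : (24 * h <= L)%N -> (1 <= L)%N ->
  512 < sigma ^+ 2 * (L %/ 2).+1%:R ->
  alpha%:R ^+ 2 <= n%:R * L.+1%:R :> R ->
  edge_rich G eta (eta / 2 ^+ (144 * h)) sigma.
Proof.
move=> Lh L1 sL asmall C s s3 Cbig degC.
(* The number of rounds: the lower bound makes [(eps / eta) ^+ t] at most 2^(-6L), hence at most
   n^(-3); the upper bound limits the loss of three cleanings to about 2^(L/4). *)
have [t t12 t24] : exists2 t, (12 * (h * t) <= L)%N & (L <= 24 * (h * t))%N.
  exists (L %/ (12 * h))%N; first by rewrite mulnA mulnC leq_trunc_div.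
  have : (0 < 12 * h)%N by rewrite muln_gt0.
  move/(ltn_ceil L); move: (L %/ (12 * h))%N => t; rewrite mulSn.
  by rewrite [(t * _)%N]mulnC -mulnA; move: (h * t)%N Lh; clear; intros; lia.
pose m := (L %/ 2)%N.
set eps := eta / _.
have two0 k : 0 < 2 ^+ k :> R by rewrite exprn_gt0.
have eps0 : 0 < eps by rewrite divr_gt0.
have n0 : 0 < n%:R :> R by rewrite ltr0n; apply: leq_trans Ln; rewrite expn_gt0.
have small : n%:R ^+ 3 * (eps / eta) ^+ t <= 1.
  have -> : eps / eta = (2 ^+ (144 * h))^-1 by rewrite /eps mulrAC divff ?gt_eqF // mul1r.
  rewrite exprVn -exprM ler_pdivrMr // mul1r -!natrX ler_nat.
  apply: leq_trans (_ : (2 ^ L.+1) ^ 3 <= _)%N; first by rewrite leq_exp2r // ltnW.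
  by rewrite -expnM leq_exp2l // -mulnA; move: (h * t)%N t24 L1; clear; intros; lia.
pose q := (3 * (h * t))%N; pose w := eta ^+ t / 2.
have w0 : 0 < w by rewrite divr_gt0 ?exprn_gt0.
have w1 : w <= 1.
  have : eta ^+ t <= 1 by rewrite exprn_ile1 // ltW.
  by rewrite /w; lra.
have w3 : (8 * 2 ^+ q)^-1 <= w ^+ 3.
  have -> : (8 * 2 ^+ q)^-1 = ((2 ^+ h)^-1 ^+ t / 2) ^+ 3 :> R.
    rewrite expr_div_n -exprM exprVn -exprM -invfM; congr (_^-1).
    rewrite mulrC; congr (_ * _); last by rewrite -natrX.
    by rewrite /q mulnC -mulnA.
  rewrite lerXn2r ?nnegrE ?(ltW w0) //.
    by rewrite divr_ge0 // exprn_ge0 // invr_ge0 ltW.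
  by rewrite ler_wpM2r ?invr_ge0 // lerXn2r ?nnegrE ?invr_ge0 ?(ltW (two0 _)) // ltW.
pose X : R := (8 * 2 ^+ q)^-1 * (sigma * n%:R).
have X0 : 0 < X by rewrite mulr_gt0 ?invr_gt0 ?mulr_gt0.
have XC : X <= w ^+ size s * #|C|%:R.
  apply: le_trans (_ : w ^+ 3 * #|C|%:R <= _).
    rewrite /X; apply: ler_pM => //; first by rewrite invr_ge0 mulr_ge0 // ltW.
    by rewrite mulr_ge0 // ltW.
  by rewrite ler_wpM2r // ler_wiXn2l // ltW.
have Xbig : n%:R * L.+1%:R < X ^+ 2.
  have e2 : 64 * (L.+1%:R) < sigma ^+ 2 * 2 ^+ m.
    have h1 : 512 * m.+1%:R < sigma ^+ 2 * m.+1%:R * m.+1%:R by rewrite ltr_pM2r.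
    have h2 : sigma ^+ 2 * m.+1%:R * m.+1%:R <= sigma ^+ 2 * (4 * 2 ^+ m).
      rewrite -mulrA ler_wpM2l ?sqr_ge0 // -!natrX -!natrM ler_nat mulnn.
      exact: expn2_ge_sqr.
    have h3 : L.+1%:R <= 2 * m.+1%:R :> R by rewrite -natrM ler_nat /m; clear; lia.
    by move: h1 h2 h3; intros; lra.
  have e3 : 2 ^+ q * 2 ^+ q * 2 ^+ m <= n%:R :> R.
    rewrite -!exprD -natrX ler_nat; apply: leq_trans Ln; rewrite leq_exp2l //.
    by rewrite /q /m; move: (h * t)%N t12; clear; intros; lia.
  have e4 : 64 * L.+1%:R * (2 ^+ q * 2 ^+ q) < sigma ^+ 2 * n%:R.
    apply: lt_le_trans (_ : sigma ^+ 2 * (2 ^+ q * 2 ^+ q * 2 ^+ m) <= _).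
      by rewrite [X in sigma ^+ 2 * X]mulrC [X in _ < X]mulrA ltr_pM2r // mulr_gt0.
    by rewrite ler_wpM2l // sqr_ge0.
  have -> : X ^+ 2 = n%:R * ((sigma ^+ 2 * n%:R) / (64 * (2 ^+ q * 2 ^+ q))).
    by rewrite /X; field; rewrite gt_eqF.
  rewrite ltr_pM2l // ltr_pdivlMr ?mulr_gt0 //.
  by rewrite mulrCA mulrA.
have Xa : alpha%:R < X.
  by rewrite -(ltr_pXn2r (n := 2)) ?nnegrE ?(ltW X0) //; apply: le_lt_trans Xbig.
have X2 : 2 <= X.
  rewrite -(ler_pXn2r (n := 2)) ?nnegrE ?(ltW X0) //; apply: le_trans (ltW Xbig).
  have n2 : (2 <= n)%N by apply: leq_trans Ln; rewrite -{1}(expn1 2) leq_exp2l.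
  by rewrite -natrX -natrM ler_nat; apply: (leq_mul n2 (_ : 2 <= L.+1)%N).
have [|C' [C'C C'w good]] := drc_seq eta0 eps0 eta1 small _ degC.
  exact: le_trans XC.
have /edge_of_card[c [c' [cC c'C ecc']]] : (alpha < #|C'|)%N.
  rewrite -(ltr_nat R); apply: lt_le_trans Xa _; apply: le_trans C'w; exact: XC.
exists c, c'; split=> //; try exact: (subsetP C'C).
by move=> B Bs; apply: good.
Qed.

End Rich.

(* Choice of the constants and conclusion over the reals *)
From mathcomp Require Import all_classical all_reals all_analysis.
Import Order.TTheory GRing.Theory Num.Theory.

Lemma ln_nat_le (R : realType) (n L : nat) : (0 < n)%N -> (n < 2 ^ L.+1)%N ->
  ln (n%:R : R) <= L.+1%:R.
Proof.
move=> n0 nL; apply: le_trans (_ : ln (2 ^+ L.+1 : R) <= _).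
  by rewrite ler_ln ?posrE ?exprn_gt0 ?ltr0n // -natrX ler_nat ltnW.
rewrite lnXn // -[leLHS]mulr_natl ler_piMr //.
by apply: (@le_ln1Dx R 1); apply: lt_trans ltr01; rewrite ltrN10.
Qed.

(** [eps] comes before [sigma], because the [sigma] of [few_edges_of_rich] depends on [eps]. *)
Lemma rich_of_independence_number (R : realType) (eta : R) : 0 < eta -> eta <= 1 ->
  exists eps : R, [/\ 0 < eps, eps <= 1 & forall sigma : R, 0 < sigma ->
    exists2 delta : R, 0 < delta & forall (T : finType) (G : sgraph T), (0 < #|T|)%N ->
      (independence_number G)%:R <= delta * Num.sqrt (#|T|%:R * ln #|T|%:R) ->
      triangle_rich G sigma /\ edge_rich G eta eps sigma].
Proof.
move=> eta0 eta1.
pose h := Num.bound eta^-1.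
have h_gt : eta^-1 < h%:R by apply: archi_boundP; rewrite invr_ge0 ltW.
have h0 : (0 < h)%N by rewrite -(ltr0n R); apply: lt_trans h_gt; rewrite invr_gt0.
have hE : (2 ^+ h)^-1 <= eta.
  rewrite invf_ple ?posrE ?exprn_gt0 //; apply: le_trans (ltW h_gt) _.
  by rewrite -natrX ler_nat ltnW // ltn_expl.
have two1 : 1 <= 2 ^+ (144 * h) :> R by rewrite exprn_ege1 // ler1n.
have two0 : 0 < 2 ^+ (144 * h) :> R by rewrite exprn_gt0.
exists (eta / 2 ^+ (144 * h)); split.
- by rewrite divr_gt0.
- by rewrite ler_pdivrMr // mul1r (le_trans eta1).
move=> sigma sigma0.
have sigma2 : 0 < sigma ^+ 2 by rewrite exprn_gt0.
pose Q := Num.bound (sigma^-1 + (sigma ^+ 2)^-1).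
have [Q1 Q2] : 1 < sigma * Q%:R /\ 1 < sigma ^+ 2 * Q%:R.
  have i1 : 0 < sigma^-1 by rewrite invr_gt0.
  have i2 : 0 < (sigma ^+ 2)^-1 by rewrite invr_gt0.
  have : sigma^-1 + (sigma ^+ 2)^-1 < Q%:R.
    by apply: archi_boundP; rewrite addr_ge0 // ltW.
  rewrite -(ltr_pdivrMl _ _ sigma0) -(ltr_pdivrMl _ _ sigma2) !mulr1.
  by move: i1 i2; clear; intros; split; lra.
pose L0 := (24 * h + 1024 * Q + 16)%N.
have P0 : 0 < 2 ^+ L0 * L0.+1%:R :> R by rewrite mulr_gt0 ?exprn_gt0.
(* The last term disposes of small graphs: below the threshold [L0] it would force alpha < 1,
   although a single vertex is independent. The term [sigma / 128] serves the triangles, 1 the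
   edges. *)
pose delta : R := Num.min (Num.min 1 (sigma / 128)) (2 ^+ L0 * L0.+1%:R)^-1.
have d0 : 0 < delta by rewrite !lt_min ltr01 invr_gt0 P0 divr_gt0.
have [d1 ds dP] : [/\ delta <= 1, delta <= sigma / 128 & delta * (2 ^+ L0 * L0.+1%:R) <= 1].
  split; first by rewrite !ge_min lexx.
    by rewrite !ge_min lexx orbT.
  by rewrite -ler_pdivlMr // div1r ge_min lexx orbT.
have dd : delta ^+ 2 <= delta by rewrite ler_iXnr // ltW.
exists delta => // T G T0 asmall.
set n := #|T| in T0 asmall; set a := independence_number G in asmall.
pose L := trunc_log 2 n.
have Ln : (2 ^ L <= n)%N by apply: trunc_logP.
have nL : (n < 2 ^ L.+1)%N by apply: trunc_log_ltn.
have a2 : a%:R ^+ 2 <= delta * (n%:R * L.+1%:R).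
  have lnn : 0 <= ln (n%:R : R) by rewrite ln_ge0 // ler1n.
  have : a%:R ^+ 2 <= (delta * Num.sqrt (n%:R * ln n%:R)) ^+ 2.
    by rewrite lerXn2r ?nnegrE ?mulr_ge0 ?sqrtr_ge0 // ltW.
  rewrite exprMn sqr_sqrtr ?mulr_ge0 // => /le_trans; apply.
  apply: ler_pM => //; [exact: sqr_ge0|exact: mulr_ge0|].
  by rewrite ler_wpM2l // ln_nat_le.
have N0 : 0 < n%:R * L.+1%:R :> R by rewrite mulr_gt0 // ltr0n.
have L0L : (L0 <= L)%N.
  rewrite leqNgt; apply/negP => LL0.
  have [x _] : exists x, x \in [set: T] by apply/set0Pn; rewrite -card_gt0 cardsT.
  have a1 : (0 < a)%N.
    rewrite -[X in (X <= _)%N](cards1 x); apply: independent_card.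
    by apply/independentP => u v; rewrite !inE => /eqP-> /eqP->; rewrite adj_irrefl.
  have : 1 <= a%:R ^+ 2 :> R by rewrite exprn_ege1 // ler1n.
  rewrite leNgt => /negP[]; apply: le_lt_trans a2 _; apply: lt_le_trans dP.
  rewrite ltr_pM2l // -natrX -!natrM ltr_nat.
  apply: leq_trans (_ : (2 ^ L.+1 * L.+1 <= _)%N).
    by rewrite ltn_mul2r.
  by rewrite leq_mul // ?leq_exp2l // ltnS ltnW.
have [L24 L1024 L16] : [/\ (24 * h <= L)%N, (1024 * Q <= L)%N & (16 <= L)%N].
  by split; move: L0L; rewrite /L0; clear; lia.
have Q8 : (2 * Q <= L %/ 8)%N by move: L1024; clear; lia.
have Q512 : (512 * Q <= (L %/ 2).+1)%N by move: L1024; clear; lia.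
split.
  apply: (triangle_rich_of_alpha sigma0 Ln) => //.
    apply: lt_le_trans (_ : sigma * (2 * Q)%:R <= _).
      by rewrite natrM; move: Q1; set x := Q%:R; clear; intros; lra.
    by rewrite ler_wpM2l ?(ltW sigma0) // ler_nat.
  apply: le_lt_trans (_ : sigma / 2 * (n%:R * L.+1%:R) < _); last first.
    by rewrite ltr_pM2r //; move: sigma0; clear; intros; lra.
  apply: le_trans (_ : 64 * (sigma / 128 * (n%:R * L.+1%:R)) <= _).
    by rewrite ler_wpM2l // (le_trans a2) // ler_wpM2r // ltW.
  by set x := n%:R * _; clear; lra.
apply: (edge_rich_of_alpha sigma0 Ln nL) => //; first exact: leq_trans L16.
  apply: lt_le_trans (_ : sigma ^+ 2 * (512 * Q)%:R <= _).
    by rewrite natrM; move: Q2; set x := Q%:R; set y := sigma ^+ 2; clear; intros; lra.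
  by rewrite ler_wpM2l ?(ltW sigma2) // ler_nat.
by apply: le_trans a2 _; rewrite ler_piMl // ltW.
Qed.

Theorem theorem1p3 (R : realType) (gamma : R) (gamma_gt0 : 0 < gamma) :
  exists delta : R, 0 < delta /\
    forall (n : nat) (T : finType) (G : sgraph T),
      #|T| = n ->
      ~ contains_copy (complete_graph 8) G ->
      (independence_number G)%:R <= delta * Num.sqrt (n%:R * ln n%:R) ->
      (num_edges G)%:R <= n%:R ^+ 2 / 4 + gamma * n%:R ^+ 2.
Proof.
(* Capping [gamma] ensures [g / 8 <= 1], as dependent random choice requires of [eta]. *)
pose g := Num.min gamma 1.
have g0 : 0 < g by rewrite lt_min gamma_gt0 ltr01.
have gg : g <= gamma by rewrite ge_min lexx.
have g1 : g <= 1 by rewrite ge_min lexx orbT.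
have [||eps [eps0 eps1 rich]] := @rich_of_independence_number R (g / 8).
- by rewrite divr_gt0.
- by move: g1; clear; intros; lra.
have [sigma sigma0 few] := few_edges_of_rich g0 eps0 eps1.
have [delta delta0 deltaP] := rich sigma sigma0.
exists delta; split=> // _ T G <- noK8 asmall.
apply: le_trans (_ : #|T|%:R ^+ 2 / 4 + g * #|T|%:R ^+ 2 <= _); last first.
  by rewrite lerD2l ler_wpM2r // exprn_ge0.
(* Richness is available only for nonempty graphs; the empty one has no edges. *)
have [T0|T0] := posnP #|T|.
  suff -> : num_edges G = 0%N by rewrite T0 !expr0n /= mul0r mulr0 addr0.
  by apply/eqP; have := num_edges_le G; rewrite /edge_count big1 => [|x _];
    [rewrite leqn0 muln_eq0|have := card0_eq T0 x].
have [tri edg] := deltaP T G T0 asmall.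
by apply: few => // /has_clique_copy.
Qed.
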